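(* Let $k\ge 2$, $3\le r\le 2k$ and $n\ge 100k$ be integers. Suppose that $G$ is an $n$-vertex graph that contains no cycle $C_{2k+1}$ of length $2k+1$ as a subgraph, and that \[ e(G)\ge \left\lfloor \frac{(n-r+1)^2}{4}\right\rfloor+\binom{r}{2}. \] Then $G\in \mathcal{G}_{n,r}$, unless $G$ is obtained from the balanced complete bipartite graph $T_{n-r+1,2}$ by suspending a complete graph $K_r$ (i.e., $G$ is the union of $T_{n-r+1,2}$ and $K_r$ sharing exactly one vertex).
   Context: $e(G)$ denotes the number of edges of $G$. $T_{m,2}$ denotes the complete bipartite graph on $m$ vertices whose two parts have sizes $\lfloor m/2\rfloor$ and $\lceil m/2\rceil$. A graph $H$ is said to be suspended on a graph $B$ if $H$ intersects $B$ in exactly one vertex. $\mathcal{G}_{n,r}$ is the family of $n$-vertex graphs that are obtained from a bipartite graph $B$ by suspending graphs $G_1,\dots,G_s$ on $B$ (for some $s\in\mathbb{N}$), i.e. the graph is $B\cup G_1\cup\dots\cup G_s$ with each $G_i$ meeting $B$ in exactly one vertex, where $\sum_{i=1}^s |V(G_i)\setminus V(B)|\le r-2$. *)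

(* Defs.v *)
From mathcomp Require Import all_boot.
Set Implicit Arguments. Unset Strict Implicit. Unset Printing Implicit Defensive.

Definition simple_graph (T : finType) (e : rel T) : Prop :=
  symmetric e /\ irreflexive e.

Definition edge_count (T : finType) (e : rel T) : nat :=
  #|[set p : T * T | e p.1 p.2]| %/ 2.

Definition has_cycle (T : finType) (e : rel T) (m : nat) : Prop :=
  exists f : 'I_m -> T, injective f /\ forall i : 'I_m, e (f i) (f (ordS i)).

(* The family G_{n,r} (n = #|T|): G = B ∪ G_1 ∪ ... ∪ G_s, where B is a
   bipartite subgraph with vertex set VB, each G_i (vertex set V i, edge
   relation eG i) is a subgraph meeting VB in exactly one vertex, the G_i
   are pairwise disjoint outside B, the union covers all vertices and all
   edges of G, and sum_i |V(G_i) \ V(B)| <= r - 2. *)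
Definition in_Gnr (T : finType) (e : rel T) (r : nat) : Prop :=
  exists (VB : {set T}) (eB : rel T) (s : nat)
         (V : 'I_s -> {set T}) (eG : 'I_s -> rel T),
    (forall x y, eB x y -> [&& x \in VB, y \in VB & e x y]) /\
    (exists X : {set T}, forall x y, eB x y -> (x \in X) != (y \in X)) /\
    (forall i x y, eG i x y -> [&& x \in V i, y \in V i & e x y]) /\
    (forall i, #|V i :&: VB| = 1) /\
    (forall i j, i != j -> V i :&: V j \subset VB) /\
    (forall x, x \in VB \/ exists i, x \in V i) /\
    (forall x y, e x y -> eB x y \/ exists i, eG i x y) /\
    \sum_(i < s) #|V i :\: VB| <= r - 2.

Definition bip_with_clique (T : finType) (e : rel T) (m r : nat) : Prop :=
  exists X Y K : {set T},
    [disjoint X & Y] /\ #|X| = m./2 /\ #|X :|: Y| = m /\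
    #|K| = r /\ #|K :&: (X :|: Y)| = 1 /\
    X :|: Y :|: K = setT /\
    (forall x y, e x y =
          [|| (x \in X) && (y \in Y), (x \in Y) && (y \in X)
            | [&& x \in K, y \in K & x != y]]).

(* Main.v *)
Require Import Defs.
From mathcomp Require Import all_boot.
From mathcomp Require Import zify.
Set Implicit Arguments. Unset Strict Implicit. Unset Printing Implicit Defensive.

(* Choose a vertex set [S] maximizing 8 d(S) - 3 |S|^2, where d(S) counts ordered
   adjacent pairs in [S].  Then degrees into [S] are at least about 3|S|/8 inside
   [S] and at most about that outside.  Such density lets an odd cycle of length
   less than 2k+1 grow by two at a time, so [S] contains no triangle and no C_5;
   hence it is bipartite, and it has more than 8n/9 vertices.  Any two vertices of
   [S] are joined in [S] by short paths of every length of the right parity, so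
   an ear on [S] (a path between two vertices of [S] running outside [S]) of wrong
   parity has at least 2k-1 inner vertices.

   Call an outside vertex pendant if it has at most one neighbour in [S].  Edge
   counting shows that there are at most r-1 pendant vertices, and r-1 only if all
   outside vertices are pendant and every estimate is tight, which gives the
   extremal graph.  If there are at most r-2, an ear of wrong parity of minimal
   length has only pendant vertices in its interior, except possibly the first
   and the last one; the few ears long enough contradict the edge count.  Without
   ears of wrong parity, [S] can be extended ear by ear, staying bipartite, until
   no ear is left; what remains outside is then attached at single vertices. *)

(** * Odd cycles in dense vertex sets *)

Lemma has_cycle_seq (T : finType) (e : rel T) (s : seq T) :
  0 < size s -> uniq s -> cycle e s -> has_cycle e (size s).
Proof.
case: s => [//|x p] _ Us /= /(pathP x) Hp.
exists (fun i : 'I_(size p).+1 => nth x (x :: p) i); split=> [i j /eqP|i].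
  by rewrite nth_uniq // => /eqP/val_inj.
have := Hp i; rewrite size_rcons => /(_ (ltn_ord i)).
rewrite -rcons_cons !nth_rcons /= ltn_ord.
have [lti|gei] := ltnP i (size p).
  by rewrite modn_small.
have -> : i = size p :> nat by apply/eqP; rewrite eqn_leq gei -ltnS ltn_ord.
by rewrite eqxx modnn.
Qed.

Section SetCounting.
Variable T : finType.
Implicit Types A B C D S : {set T}.

(** Inclusion-exclusion, with [C] taking up room in [S] outside [A :|: B]. Applied to
    neighbourhoods, it yields many common neighbours. *)
Lemma leq_card_setI_disjoint A B C S :
  A \subset S -> B \subset S -> C \subset S ->
  [disjoint C & A] -> [disjoint C & B] ->
  #|A| + #|B| + #|C| <= #|S| + #|A :&: B|.
Proof.
move=> As Bs Cs dA dB.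
have dU : [disjoint A :|: B & C].
  by rewrite -setI_eq0 setIUl setU_eq0 !setI_eq0 ![[disjoint _ & C]]disjoint_sym dA.
rewrite -cardsUI addnAC leq_add2r.
rewrite -(cardsUI (A :|: B) C).
move: dU; rewrite -setI_eq0 => /eqP ->; rewrite cards0 addn0.
by apply: subset_leq_card; rewrite !subUset As Bs Cs.
Qed.

Lemma three_sets_meet A B C S :
  A \subset S -> B \subset S -> C \subset S -> #|S| < #|A| + #|B| + #|C| ->
  [\/ exists x, x \in A :&: B, exists x, x \in B :&: C
    | exists x, x \in A :&: C].
Proof.
move=> As Bs Cs lt.
have [/set0Pn|AB0] := boolP (A :&: B != set0); first by constructor 1.
have [/set0Pn|BC0] := boolP (B :&: C != set0); first by constructor 2.
have [/set0Pn|AC0] := boolP (A :&: C != set0); first by constructor 3.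
have := @leq_card_setI_disjoint A B C S As Bs Cs.
move: AB0 BC0 AC0; rewrite !negbK => /eqP-> BC0 AC0.
rewrite -!setI_eq0 cards0 addn0 ![C :&: _]setIC => /(_ AC0 BC0).
by rewrite leqNgt lt.
Qed.

End SetCounting.

Section Graph.
Variables (T : finType) (e : rel T).
Hypotheses (e_sym : symmetric e) (e_irr : irreflexive e).
Implicit Types (S A : {set T}) (p q s : seq T) (x y u v : T).

Definition nbr S x : {set T} := [set y in S | e x y].

Lemma in_nbr S x y : (y \in nbr S x) = (y \in S) && e x y.
Proof. by rewrite inE. Qed.

Lemma nbr_sub S x : nbr S x \subset S.
Proof. by apply/subsetP=> y; rewrite in_nbr => /andP[]. Qed.

Lemma adj_neq x y : e x y -> x != y.
Proof. by apply: contraTneq => ->; rewrite e_irr. Qed.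

Lemma leq_card_nbrD S A x : #|nbr S x| <= #|nbr (S :\: A) x| + #|A|.
Proof.
apply: leq_trans (leq_card_setU _ _).
apply: subset_leq_card; apply/subsetP=> y; rewrite !inE.
by case: (y \in A); rewrite ?orbT //= orbF.
Qed.

(* Either some edge of the cycle can be replaced by a path of length 3, or the
   two neighbours of a cycle vertex have so many common neighbours that the
   path through that vertex can be replaced by one of length 4. *)
Lemma odd_cycle_extend S h c1 c2 c3 q :
  (forall x, x \in S -> h <= #|nbr S x|) ->
  #|S| + 2 * (size q + 3) + 3 <= 3 * h ->
  {subset [:: c1, c2, c3 & q] <= S} ->
  uniq [:: c1, c2, c3 & q] -> cycle e [:: c1, c2, c3 & q] ->
  exists s, [/\ size s = size q + 5, {subset s <= S}, uniq s & cycle e s].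
Proof.
move=> hS big sS Uc cyc.
pose C := [set x in [:: c1, c2, c3 & q]].
have cardC : #|C| = size q + 3 by rewrite cardsE (card_uniqP Uc) /= addn3.
have CS : C \subset S by apply/subsetP=> x; rewrite inE; apply: sS.
pose D := S :\: C.
have cardD : #|D| = #|S| - #|C| by rewrite cardsDS.
have leCS := subset_leq_card CS.
have hD x : x \in S -> h <= #|nbr D x| + #|C|.
  by move=> /hS hx; apply: leq_trans hx (leq_card_nbrD _ _ _).
have c1S : c1 \in S by apply: sS; rewrite !inE eqxx.
have c2S : c2 \in S by apply: sS; rewrite !inE eqxx ?orbT.
have c3S : c3 \in S by apply: sS; rewrite !inE eqxx ?orbT.
have qS x : x \in q -> x \in S by move=> xq; apply: sS; rewrite !inE xq ?orbT.
have DP x : x \in D -> [/\ x \in S, x != c1, x != c2, x != c3 & x \notin q].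
  by rewrite !inE !negb_or => /andP[/and4P[-> -> -> ->] ->].
move: (Uc) (cyc); rewrite /= !inE !negb_or.
move=> /and4P[/and3P[n12 n13 n1q] /andP[n23 n2q] n3q Uq] /and3P[e12 e23 pq].
have [/existsP[a /existsP[b /and3P[aN bN eab]]]|no12] :=
    boolP [exists a, exists b, [&& a \in nbr D c1, b \in nbr D c2 & e a b]].
  move: aN bN; rewrite !in_nbr.
  move=> /andP[/DP[aS a1 a2 a3 aq] e1a] /andP[/DP[bS b1 b2 b3 bq] e2b].
  exists [:: c1, a, b, c2, c3 & q]; split; first by rewrite /= !addnS addn0.
  - by move=> x; rewrite !inE => /or4P[/eqP->|/eqP->|/eqP->|/or3P[/eqP->|/eqP->|/qS]].
  - rewrite /= !inE !negb_or n12 n13 n1q n23 n2q n3q Uq aq bq a2 a3 b2 b3.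
    by rewrite (adj_neq eab) eq_sym a1 eq_sym b1.
  - by rewrite /= e1a eab e_sym e2b e23 pq.
have [/existsP[a /existsP[b /and3P[aN bN eab]]]|no23] :=
    boolP [exists a, exists b, [&& a \in nbr D c2, b \in nbr D c3 & e a b]].
  move: aN bN; rewrite !in_nbr.
  move=> /andP[/DP[aS a1 a2 a3 aq] e1a] /andP[/DP[bS b1 b2 b3 bq] e2b].
  exists [:: c1, c2, a, b, c3 & q]; split; first by rewrite /= !addnS addn0.
  - by move=> x; rewrite !inE => /or4P[/eqP->|/eqP->|/eqP->|/or3P[/eqP->|/eqP->|/qS]].
  - rewrite /= !inE !negb_or n12 n13 n1q n23 n2q n3q Uq aq bq a3 b3.
    by rewrite (adj_neq eab) eq_sym a1 eq_sym b1 eq_sym a2 eq_sym b2.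
  - by rewrite /= e12 e1a eab e_sym e2b pq.
have [a aN] : exists a, a \in nbr D c2.
  by apply/set0Pn; rewrite -card_gt0; move: (hD _ c2S) big cardC leCS; clear; lia.
have aS : a \in S by move: aN; rewrite in_nbr => /andP[/DP[]].
(* [N(a)] misses [N(c1)] and [N(c3)], as both searches failed. Each neighbourhood loses at most
   [#|C|] in passing to [D], so [big] leaves three common neighbours of [c1] and [c3]. *)
have : #|nbr D c1| + #|nbr D c3| + #|nbr D a| <= #|D| + #|nbr D c1 :&: nbr D c3|.
  apply: leq_card_setI_disjoint; rewrite ?nbr_sub //; apply/pred0P=> b /=;
    apply/negP=> /andP[]; rewrite [b \in nbr D a]in_nbr => /andP[bD eab] bN.
  - move/negP: no12; apply; apply/existsP; exists b; apply/existsP; exists a.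
    by rewrite bN aN e_sym.
  - move/negP: no23; apply; apply/existsP; exists a; apply/existsP; exists b.
    by rewrite bN aN.
move=> leI.
have gtI : 2 < #|nbr D c1 :&: nbr D c3|.
  by move: (hD _ c1S) (hD _ c3S) (hD _ aS) leI leCS cardD big cardC; clear; lia.
have finish x y w : x \in nbr D c1 :&: nbr D c3 -> y \in nbr D c1 :&: nbr D c3 ->
    x != y -> w \in nbr D x :&: nbr D y ->
  exists s, [/\ size s = size q + 5, {subset s <= S}, uniq s & cycle e s].
  rewrite !(in_setI, in_nbr).
  move=> /andP[/andP[/DP[xS x1 x2 x3 xq] e1x] _].
  move=> /andP[/andP[/DP[yS y1 y2 y3 yq] _] /andP[_ e3y]] nxy.
  move=> /andP[/andP[/DP[wS w1 w2 w3 wq] exw] /andP[_ eyw]].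
  exists [:: c1, x, w, y, c3 & q]; split; first by rewrite /= !addnS addn0.
  - by move=> z; rewrite !inE => /or4P[/eqP->|/eqP->|/eqP->|/or3P[/eqP->|/eqP->|/qS]].
  - rewrite /= !inE !negb_or n13 n1q n3q Uq xq yq wq x3 y3 w3 nxy (adj_neq exw).
    by rewrite [w == y]eq_sym (adj_neq eyw) eq_sym x1 eq_sym w1 eq_sym y1.
  - by rewrite /= e1x exw [e w y]e_sym eyw e_sym e3y.
(* Among three common neighbours of [c1] and [c3], two share a neighbour [w] in [D]. *)
have /card_gt2P[x [y [z [[xI yI zI] [nxy nyz nzx]]]]] := gtI.
have IS t : t \in nbr D c1 :&: nbr D c3 -> t \in S.
  by rewrite in_setI in_nbr => /andP[/andP[/DP[]]].
have [||| |[w wI]|[w wI]|[w wI]] := @three_sets_meet _ (nbr D x) (nbr D y) (nbr D z) D;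
  rewrite ?nbr_sub //.
- by move: (hD _ (IS _ xI)) (hD _ (IS _ yI)) (hD _ (IS _ zI)) leCS cardD big cardC; clear; lia.
- exact: (finish x y w).
- exact: (finish y z w).
- by apply: (finish x z w); rewrite 1?eq_sym.
Qed.

(** A shorter odd cycle in [S] would grow by two at a time up to length [2 * k + 1]. The last
    extension starts from length [2 * k - 1], and [2 * (2 * k - 1) + 3] is [4 * k + 1]. *)
Lemma no_short_odd_cycle S h k :
  (forall x, x \in S -> h <= #|nbr S x|) -> #|S| + 4 * k + 1 <= 3 * h ->
  (forall s, uniq s -> cycle e s -> size s <> (2 * k).+1) ->
  forall j s, 0 < j <= k -> {subset s <= S} -> uniq s -> cycle e s ->
    size s <> (2 * j).+1.
Proof.
move=> hS big nocyc j s /andP[j0 jk].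
have -> : j = k - (k - j) by rewrite subKn.
have : k - j < k by move: j0 jk; clear; lia.
elim: (k - j) s => [|i IH] s ltik sS Us cs szs.
  by apply: (nocyc s); rewrite // szs subn0.
case: s sS Us cs szs => [|c1 [|c2 [|c3 q]]] sS Us cs szs;
  try by move: szs ltik => /=; clear; lia.
have szq : size q + 5 = (2 * (k - i)).+1 by move: szs ltik => /=; clear; lia.
have [|s' [szs' s'S Us' cs']] := odd_cycle_extend hS _ sS Us cs.
  by move: big szq; clear; lia.
by apply: (IH s') => //; move: ltik szs' szq; clear; lia.
Qed.

Definition proper_col (c : T -> bool) S :=
  forall x y, x \in S -> y \in S -> e x y -> c x != c y.

(* Of three vertices two have a common neighbour; the colour classes are the
   vertices that do, respectively do not, share a neighbour with a fixed [u]. *)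
Lemma bipartite_of_no_C3_C5 S h :
  (forall x, x \in S -> h <= #|nbr S x|) -> #|S| < 3 * h ->
  (forall s, {subset s <= S} -> uniq s -> cycle e s -> size s <> 3) ->
  (forall s, {subset s <= S} -> uniq s -> cycle e s -> size s <> 5) ->
  exists c, proper_col c S.
Proof.
move=> hS big no3 no5.
have no_tri x y z : x \in S -> y \in S -> z \in S -> e x y -> e y z -> e z x -> False.
  move=> xS yS zS xy yz zx; apply: (no3 [:: x; y; z]) => //.
  - by move=> t; rewrite !inE => /or3P[/eqP->|/eqP->|/eqP->].
  - by rewrite /= !inE negb_or (adj_neq xy) eq_sym (adj_neq zx) (adj_neq yz).
  - by rewrite /= xy yz zx.
have [->|/set0Pn[u uS]] := eqVneq S set0.
  by exists xpredT => x y; rewrite inE.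
pose c x := [exists w, w \in nbr S u :&: nbr S x].
exists c => x y xS yS exy.
have cP t : c t -> exists w, [/\ w \in S, e u w & e t w].
  by move=> /existsP[w]; rewrite in_setI !in_nbr => /andP[/andP[] ? ? /andP[]]; exists w.
(* If both [x] and [y] share a neighbour with [u], the closed walk [u w x y w'] is a [C_5], since
   any coincidence of its vertices would leave a triangle. *)
apply/negP => /eqP cxy; case cx: (c x); rewrite cx in cxy.
  have [w [wS uw xw]] := cP _ cx.
  have [w' [w'S uw' yw']] := cP _ (esym cxy).
  have nww' : w != w'.
    by apply: contraTneq yw' => <-; apply/negP=> yw; apply: (no_tri x y w); rewrite // e_sym.
  have nux : u != x.
    by apply: contraTneq exy => <-; apply/negP=> uy; apply: (no_tri u y w'); rewrite // e_sym.
  have nuy : u != y.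
    by apply: contraTneq exy => <-; apply/negP=> xu; apply: (no_tri x u w); rewrite // e_sym.
  have nwy : w != y.
    by apply: contraTneq uw => ->; apply/negP=> uy; apply: (no_tri u y w'); rewrite // e_sym.
  have nxw' : x != w'.
    by apply: contraTneq uw' => <-; apply/negP=> ux; apply: (no_tri u x w); rewrite // e_sym.
  apply: (no5 [:: u; w; x; y; w']) => //.
  - by move=> t; rewrite !inE => /or4P[/eqP->|/eqP->|/eqP->|/orP[/eqP->|/eqP->]].
  - rewrite /= !inE !negb_or (adj_neq uw) nux nuy (adj_neq uw') nww' nwy nxw'.
    by rewrite (adj_neq exy) (adj_neq yw') eq_sym (adj_neq xw).
  - by rewrite /= uw [e w x]e_sym xw exy yw' e_sym uw'.
(* If neither does, only the neighbourhoods of [x] and [y] can meet, and they would give a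
   triangle. *)
have [||| |[w]|[w]|[w]] := @three_sets_meet _ (nbr S u) (nbr S x) (nbr S y) S;
  rewrite ?nbr_sub //.
- by move: (hS _ uS) (hS _ xS) (hS _ yS) big; clear; lia.
- by move=> wI; move/existsP: cx; apply; exists w.
- rewrite in_setI !in_nbr => /andP[/andP[wS xw] /andP[_ yw]].
  by apply: (no_tri x y w); rewrite // e_sym.
- by move=> wI; move/existsP: (esym cxy); apply; exists w.
Qed.

End Graph.

(** * Ears *)

Section Ears.
Variables (T : finType) (e : rel T).
Hypotheses (e_sym : symmetric e) (e_irr : irreflexive e).
Implicit Types (S A : {set T}) (p q r s : seq T) (x y u v : T) (c : T -> bool).

(** The list [p] holds the inner vertices only, so the length of the path is [(size p).+1]. *)
Local Notation link u v p := (path e u (rcons p v)).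

Lemma link_cat u v x p q : link u v (p ++ x :: q) = link u x p && link x v q.
Proof. by rewrite -cat_rcons rcons_cat cat_path last_rcons. Qed.

Lemma link_rev u v p : link v u (rev p) = link u v p.
Proof.
rewrite -rev_cons -[X in rcons p X](last_rcons u p v).
rewrite -[u :: p](belast_rcons u p v) last_rcons.
rewrite -{1}(last_rcons u p v) rev_path.
by apply: eq_path => x y; rewrite e_sym.
Qed.

(** The path is built greedily from [u], each new vertex joining the forbidden set [A]; [B] bounds
    the forbidden vertices plus those still to be chosen. The last inner vertex is a common
    neighbour of the current vertex and [v]. *)
Lemma proper_link c S h B :
  proper_col e c S -> (forall x, x \in S -> h <= #|nbr e S x|) ->
  #|S| + B < 3 * h -> B < h ->
  forall l u v A, 0 < l -> #|A| + l <= B -> u \in S -> v \in S -> v \in A ->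
    c u (+) c v = ~~ odd l ->
  exists p, [/\ size p = l, {subset p <= S :\: A}, uniq p & link u v p].
Proof.
move=> pr hS big ltBh; elim=> [//|[|l] IH] u v A _ leA uS vS vA cuv.
  have [w wN] : exists w, w \in nbr e S u.
    by apply/set0Pn; rewrite -card_gt0; move: (hS _ uS) ltBh; clear; lia.
  move: (wN); rewrite in_nbr => /andP[wS uw].
  have cuw := pr _ _ uS wS uw.
  (* Here [u] and [v] have the same colour and [w] the other one, so [N(w)] is disjoint from [N(u)]
     and [N(v)]. *)
  have leI : #|nbr e S u| + #|nbr e S v| + #|nbr e S w|
      <= #|S| + #|nbr e S u :&: nbr e S v|.
    apply: leq_card_setI_disjoint; rewrite ?nbr_sub //; apply/pred0P => b /=;
      apply/negP; rewrite !in_nbr => /andP[/andP[bS wb] /andP[_ ub]];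
      move: (pr _ _ wS bS wb) cuw cuv.
    - by move: (pr _ _ uS bS ub); case: (c u); case: (c w); case: (c b).
    - by move: (pr _ _ vS bS ub); case: (c u); case: (c w); case: (c b); case: (c v).
  have /subsetPn[x] : ~~ (nbr e S u :&: nbr e S v \subset A).
    apply/negP => /subset_leq_card.
    by move: leI (hS _ uS) (hS _ vS) (hS _ wS) big leA; clear; lia.
  rewrite in_setI !in_nbr => /andP[/andP[xS ux] /andP[_ vx]] xA.
  exists [:: x]; split=> //=; last by rewrite ux e_sym vx.
  by move=> y; rewrite in_cons orbF => /eqP->; rewrite in_setD xA xS.
have /subsetPn[y] : ~~ (nbr e S u \subset A).
  by apply/negP => /subset_leq_card; move: (hS _ uS) leA ltBh; clear; lia.
rewrite in_nbr => /andP[yS uy] yA.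
have [|||p [szp pS Up yp]] := IH y v (y |: A) isT _ yS vS.
- by rewrite cardsU1 yA; move: leA; clear; lia.
- by rewrite in_setU1 vA orbT.
- move: (pr _ _ uS yS uy) cuv => /=.
  by case: (c u); case: (c y); case: (c v); case: (odd l).
exists (y :: p); split; rewrite /= ?szp ?uy ?Up ?andbT //.
- move=> x; rewrite in_cons => /orP[/eqP->|/pS]; first by rewrite in_setD yA yS.
  by rewrite !in_setD in_setU1 negb_or => /andP[/andP[_ ->] ->].
- by apply/negP => /pS; rewrite in_setD in_setU1 eqxx.
Qed.

(** The case [p = [::]] is an edge inside [S], so [ears_ok] below includes properness of the
    colouring on [S]. *)
Definition ear S u v p :=
  [&& u \in S, v \in S, u != v, link u v p, uniq p & all (fun x => x \notin S) p].

Lemma ear_rev S u v p : ear S u v p -> ear S v u (rev p).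
Proof.
by case/and5P=> uS vS nuv l /andP[Up Sp];
  rewrite /ear uS vS eq_sym nuv link_rev l rev_uniq all_rev Up.
Qed.

(* The length [(size p).+1] of the ear has the parity prescribed by the colours
   of its ends. *)
Definition ear_ok c u v p := c u (+) c v = ~~ odd (size p).

Lemma ear_okN c u v p : ~ ear_ok c u v p -> c u (+) c v = odd (size p).
Proof. by rewrite /ear_ok; case: (_ (+) _); case: odd. Qed.

Lemma cycle_of_ear S u v p q :
  ear S u v p -> link v u q -> uniq q -> {subset q <= S :\: [set u; v]} ->
  uniq (u :: p ++ v :: q) /\ cycle e (u :: p ++ v :: q).
Proof.
case/and5P=> uS vS nuv lp /andP[Up /allP pS] lq Uq qS.
have nq x : x \in q -> [/\ x \in S, x != u & x != v].
  by move/qS; rewrite in_setD in_set2 negb_or => /andP[/andP[]].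
split; last by rewrite /cycle link_cat lp lq.
rewrite cons_uniq cat_uniq cons_uniq mem_cat in_cons [has _ (v :: q)]/= !negb_or Up Uq nuv.
have -> : u \notin p by apply/negP => /pS; rewrite uS.
have -> : v \notin p by apply/negP => /pS; rewrite vS.
have -> : u \notin q by apply/negP => /nq[_]; rewrite eqxx.
have -> : v \notin q by apply/negP => /nq[_ _]; rewrite eqxx.
suff -> : ~~ has (mem p) q by [].
by apply/hasPn => x /nq[xS _ _]; apply/negP => /pS; rewrite xS.
Qed.

Section NoOddCycle.
Variables (S : {set T}) (c : T -> bool) (h k : nat).
Hypotheses (pr : proper_col e c S) (hS : forall x, x \in S -> h <= #|nbr e S x|).
Hypotheses (big : #|S| + (2 * k).+1 < 3 * h) (ltkh : (2 * k).+1 < h).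
Hypothesis nocyc : forall s, uniq s -> cycle e s -> size s <> (2 * k).+1.

(** An ear of wrong parity could be closed inside [S] by a path with [2 * k - 1 - size p] inner
    vertices, whose parity is right, into a cycle of length [2 * k + 1]. *)
Lemma short_ear_ok u v p : ear S u v p -> size p < (2 * k).-1 -> ear_ok c u v p.
Proof.
move=> E ltp; case: (eqVneq (c u (+) c v) (~~ odd (size p))) => // /eqP/ear_okN wr.
have /and5P[uS vS _ _ _] := E.
have [|||||| q [szq qS Uq lq]] :=
  proper_link pr hS big ltkh (l := (2 * k).-1 - size p) (u := v) (v := u) (A := [set u; v]).
- by move: ltp; clear; lia.
- by rewrite cards2; move: ltp; clear; case: (u != v) => /=; lia.
- by [].
- by [].
- by rewrite in_set2 eqxx.
- by move: wr ltp; rewrite addbC => ->; clear; lia.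
have [Us cs] := cycle_of_ear E lq Uq qS.
by case: (nocyc Us cs); rewrite /= size_cat /= szq; move: ltp; clear; lia.
Qed.

Lemma ear_nonadj u v p : 0 < k -> ear S u v p -> size p = (2 * k).-1 -> ~~ e u v.
Proof.
move=> k0 E szp; apply/negP => euv.
have [|| Us cs] := @cycle_of_ear S u v p [::] E _ isT _ => //.
  by rewrite /= e_sym euv.
by case: (nocyc Us cs); rewrite /= size_cat /= szp; move: k0; clear; lia.
Qed.

End NoOddCycle.

Definition ears_ok c S := forall u v p, ear S u v p -> ear_ok c u v p.

(** Colours alternate along the new ear. An ear of the larger set, completed by pieces of [p],
    becomes an ear of [S], whose parity is known. *)
Lemma ears_ok_add c S u v p : ears_ok c S -> ear S u v p ->
  exists c', ears_ok c' (S :|: [set x in p]).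
Proof.
move=> ok E.
have /and5P[uS vS nuv lp /andP[Up /allP pS]] := E.
have cuv := ok _ _ _ E.
pose c' x := if x \in p then c u (+) ~~ odd (index x p) else c x.
have c'S x : x \in S -> c' x = c x.
  by move=> xS; rewrite /c'; case: ifP => // /pS; rewrite xS.
have c'p p1 x p2 : p = p1 ++ x :: p2 -> c' x = c u (+) ~~ odd (size p1).
  move=> Ep; rewrite /c' Ep mem_cat mem_head orbT index_cat /= eqxx addn0.
  move: Up; rewrite Ep cat_uniq => /and3P[_ /hasPn/(_ x)]; rewrite mem_head.
  by move=> /(_ isT)/negbTE ->.
pose S' := S :|: [set x in p].
have outP r : all (fun x => x \notin S') r ->
    (forall x, x \in r -> x \notin S) /\ (forall x, x \in r -> x \notin p).
  move=> /allP rS'; split=> x /rS'; rewrite in_setU inE negb_or => /andP[] //.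
have mkear a b q : a \in S -> b \in S -> a != b -> link a b q -> uniq q ->
    (forall x, x \in q -> x \notin S) -> ear S a b q.
  by move=> aS bS nab l Uq qS; rewrite /ear aS bS nab l Uq; apply/allP.
(* With only [a] on the ear, [r] is prolonged along [p] to [u], or to [v] when [b = u]. *)
have half a b r : ear S' a b r -> a \in p -> b \in S -> ear_ok c' a b r.
  case/and5P=> _ _ nab lr /andP[Ur /outP[rS rp]] ap bS.
  move: ap; case/path.splitPr Ep : {1}p / => [p1 p2].
  have c'a := c'p _ _ _ Ep.
  move: (Up) lp; rewrite Ep cat_uniq link_cat /= => /and4P[Up1 /norP[ap1 d12] ap2 Up2] /andP[l1 l2].
  have inp x : [|| x \in p1, x == a | x \in p2] -> x \in p.
    by rewrite Ep mem_cat in_cons.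
  have nr x : [|| x \in p1, x == a | x \in p2] -> x \notin r.
    by move/inp => xp; apply/negP => /rp/negP; apply.
  have [Ebu|nbu] := eqVneq b u.
    have : ear S b v (rev r ++ a :: p2).
      apply: mkear; rewrite // ?Ebu //.
      - by rewrite link_cat link_rev -Ebu lr l2.
      - rewrite cat_uniq /= rev_uniq Ur ap2 Up2 mem_rev andbT /= negb_or.
        rewrite nr ?eqxx ?orbT ?andbT //=.
        by apply/hasPn => x xp2; rewrite mem_rev nr ?xp2 ?orbT.
      - move=> x; rewrite mem_cat mem_rev in_cons => /or3P[/rS //|xp|xp]; apply: pS;
          by rewrite inp ?xp ?orbT.
    move=> /ok; move: cuv; rewrite /ear_ok c'a (c'S b bS) Ep Ebu !size_cat /= size_rev.
    rewrite !addnS /= !oddD.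
    by case: (c u); case: (c v); case: (odd (size p1)); case: (odd (size p2)); case: (odd (size r)).
  have : ear S u b (p1 ++ a :: r).
    apply: mkear; rewrite // 1?eq_sym //.
    - by rewrite link_cat l1.
    - rewrite cat_uniq /= Up1 Ur andbT negb_or ap1 /=; apply/andP; split.
        by apply/hasPn => x xr; apply/negP => xp1; move: xr; apply/negP; rewrite nr ?xp1.
      by rewrite nr ?eqxx ?orbT.
    - move=> x; rewrite mem_cat in_cons => /or3P[xp|xp|/rS //]; apply: pS;
        by rewrite inp ?xp ?orbT.
  move=> /ok; rewrite /ear_ok c'a (c'S b bS) !size_cat /= !addnS /= !oddD.
  by case: (c u); case: (c b); case: (odd (size p1)); case: (odd (size r)).
have ear_ok_rev a b r : ear_ok c' b a (rev r) -> ear_ok c' a b r.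
  by rewrite /ear_ok size_rev addbC.
(* With both ends on the ear, [r] replaces the piece of [p] between them. *)
have both a b r p1 p2 p3 : ear S' a b r -> p = p1 ++ a :: p2 ++ b :: p3 -> ear_ok c' a b r.
  case/and5P=> _ _ nab lr /andP[Ur /outP[rS rp]] Ep.
  have c'a := c'p _ _ _ Ep.
  have c'b : c' b = c u (+) ~~ odd (size (p1 ++ a :: p2)).
    by apply: (c'p _ _ p3); rewrite Ep -catA.
  have inp x : x \notin p -> [&& x \notin p1, x != a, x \notin p2, x != b & x \notin p3].
    by rewrite Ep mem_cat in_cons mem_cat in_cons !negb_or.
  have : ear S u v (p1 ++ a :: r ++ b :: p3).
    move: (Up) (lp); rewrite Ep !link_cat => Up' /and3P[l1 l2 l3].
    apply: mkear; rewrite // ?link_cat ?l1 ?lr //.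
    - have : uniq (p1 ++ a :: [::] ++ b :: p3).
        apply: subseq_uniq Up'; apply: cat_subseq => //.
        by rewrite /= eqxx; apply: (@cat_subseq _ [::] _ p2); rewrite ?sub0seq.
      rewrite -(cat_rcons a p1 ([::] ++ b :: p3)) -(cat_rcons a p1 (r ++ b :: p3)) => U3.
      rewrite uniq_catCA cat_uniq Ur U3 andbT /=.
      apply/hasPn => x; rewrite mem_cat mem_rcons !in_cons => xp;
      apply/negP => /rp xnp; have := inp _ xnp.
      by move=> /and5P[/negbTE x1 /negbTE x2 _ /negbTE x3 /negbTE x4]; rewrite x1 x2 x3 x4 in xp.
    - move=> x; rewrite mem_cat in_cons mem_cat in_cons => /or4P[xp|xp|/rS //|xp]; apply: pS;
        rewrite Ep mem_cat in_cons mem_cat in_cons ?xp ?orbT //.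
  move: cuv => + /ok; rewrite /ear_ok c'a c'b Ep.
  rewrite !size_cat /= !size_cat /= !addnS /= !oddD.
  by case: (c u); case: (c v); case: (odd (size p1)); case: (odd (size p2));
    case: (odd (size p3)); case: (odd (size r)).
exists c' => a b r R.
have /and3P[aS' bS' /andP[nab /andP[_ /andP[_ /outP[rS rp]]]]] := R.
move: (aS') (bS'); rewrite !in_setU ![_ \in [set x in p]]inE => /orP[aS|ap] /orP[bS|bp].
- have /and5P[_ _ _ lr /andP[Ur _]] := R.
  by rewrite /ear_ok !c'S //; apply: ok; apply: mkear.
- by apply: ear_ok_rev; apply: half => //; apply: ear_rev.
- exact: half.
- move: (ap); case/path.splitPr Ep : {1}p / => [p1 p2].
  have : b \in p1 ++ a :: p2 by rewrite -Ep.
  rewrite mem_cat in_cons eq_sym (negbTE nab) /= => /orP[];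
    case/path.splitPr Eq : {1}_ / => [q1 q2].
    by apply: ear_ok_rev; apply: (both _ _ _ q1 q2 p2); rewrite ?ear_rev // Ep Eq -catA.
  by apply: (both _ _ _ p1 q1 q2); rewrite // Ep Eq.
Qed.

Lemma ear_closure c S : ears_ok c S ->
  exists S' c', [/\ S \subset S', ears_ok c' S' & forall u v p, ear S' u v p -> p = [::]].
Proof.
have [m] := ubnP #|~: S|; elim: m S c => // m IH S c ltm ok.
(* Bounding the length by [#|T|] makes the existence of a nonempty ear a boolean. *)
have [/existsP[u /existsP[v /existsP[j /existsP[p /andP[E szp]]]]]|noE] :=
    boolP [exists u, exists v, exists j : 'I_#|T|.+1, exists p : j.-tuple T,
             ear S u v p && (0 < size p)].
  have [c' ok'] := ears_ok_add ok E.
  have [|S' [c'' [sub ok'' no]]] := IH _ c' _ ok'.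
    apply: leq_trans (proper_card _) _; last by rewrite -ltnS; exact: ltm.
    rewrite properC properEneq subsetUl andbT.
    case Ep: (tval p) szp E => [//|x q] _ /and5P[_ _ _ _ /andP[_ /andP[xS _]]].
    by apply: contraNneq xS => ->; rewrite in_setU inE mem_head orbT.
  by exists S', c''; split=> //; apply: subset_trans sub; apply: subsetUl.
exists S, c; split=> // u v [//|x p] E.
have /and5P[_ _ _ _ /andP[Up _]] := E.
have ltp : size (x :: p) < #|T|.+1.
  by rewrite ltnS -(card_uniqP Up) max_card.
move/existsP: noE; case; exists u; apply/existsP; exists v; apply/existsP.
by exists (Ordinal ltp); apply/existsP; exists (in_tuple (x :: p)); rewrite E.
Qed.

(** A component of the graph outside [S] is adjacent to at most one vertex of [S], since two would
    give a nonempty ear. [B] is the graph on [S], and for each vertex of [S] the components attached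
    there form one [G_i]. *)
Lemma in_Gnr_of_closed c S (r : nat) :
  S != set0 -> ears_ok c S -> (forall u v p, ear S u v p -> p = [::]) ->
  #|~: S| <= r - 2 -> in_Gnr e r.
Proof.
move=> /set0Pn[a0 a0S] ok noE leS.
pose e' := [rel x y | [&& e x y, x \notin S & y \notin S]].
have e'_sym : connect_sym e'.
  by apply: sym_connect_sym => x y; rewrite /= e_sym [(x \notin S) && _]andbC.
have attP x y a b : x \notin S -> connect e' x y -> a \in S -> b \in S ->
    e x a -> e y b -> a = b.
  move=> xS /connectP[p0 /shortenP[p pth Up _ {p0}] ->] aS bS xa yb.
  apply/eqP; case: eqVneq => // nab.
  suff /noE : ear S a b (x :: p) by [].
  rewrite /ear aS bS nab Up /= e_sym xa xS rcons_path yb andbT /=.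
  have -> : path e x p by apply: sub_path pth => ? ? /= /andP[].
  move: pth; clear; elim: p x => //= y p IH x /andP[/and3P[_ _ ->]]; exact: IH.
(* Components without neighbours in [S] are assigned to [a0] by default. *)
pose att x := odflt a0 [pick a in S | [exists y, connect e' x y && e y a]].
have attS x : att x \in S by rewrite /att; case: pickP => //= a /andP[].
have att_nbr x a : x \notin S -> a \in S -> e x a -> att x = a.
  move=> xS aS xa; rewrite /att; case: pickP => /= [b /andP[bS /existsP[y /andP[xy yb]]]|].
    by apply/esym; apply: (attP x y).
  move=> /(_ a); rewrite aS /= => /existsP; case; exists x; by rewrite connect0.
have att_eq x y : x \notin S -> y \notin S -> e x y -> att x = att y.
  move=> xS yS xy; rewrite /att; congr odflt; apply: eq_pick => a /=.
  congr (_ && _); apply: eq_existsb => z; congr (_ && _).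
  by apply: same_connect => //; apply: connect1; rewrite /= xy xS.
pose V (i : 'I_#|S|) := enum_val i |: [set x in ~: S | att x == enum_val i].
have inV i x : (x \in V i) = (x == enum_val i) || (x \notin S) && (att x == enum_val i).
  by rewrite in_setU1 inE in_setC.
have VP x : exists i : 'I_#|S|, (x \in S -> x = enum_val i) /\ (x \notin S -> att x = enum_val i).
  have [xS|xS] := boolP (x \in S).
    by exists (enum_rank_in xS x); rewrite enum_rankK_in.
  by exists (enum_rank_in (attS x) (att x)); rewrite enum_rankK_in.
have evS (i : 'I_#|S|) : enum_val i \in S by apply: enum_valP.
exists S, (fun x y => [&& x \in S, y \in S & e x y]), #|S|, V,
  (fun i x y => [&& x \in V i, y \in V i & e x y]); do ![split] => //.
- exists [set x | c x] => x y /and3P[xS yS xy]; rewrite !inE.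
  have /ok : ear S x y [::] by rewrite /ear xS yS /= xy (adj_neq e_irr xy).
  by rewrite /ear_ok /=; case: (c x); case: (c y).
- move=> i; apply/eqP/cards1P; exists (enum_val i); apply/setP => x.
  rewrite in_setI inV in_set1; case: eqVneq => [->|_]; first by rewrite evS.
  by case: (x \in S); rewrite ?andbF.
- move=> i j nij; apply/subsetP => x; rewrite in_setI !inV.
  case: (boolP (x \in S)) => //= xS.
  have ne (l : 'I_#|S|) : (x == enum_val l) = false.
    by apply: contraNF xS => /eqP->.
  by rewrite !ne /= => /andP[/eqP-> /eqP/enum_val_inj ij]; rewrite ij eqxx in nij.
- move=> x; case: (boolP (x \in S)) => xS; [by left|right].
  by have [i [_ /(_ xS) ax]] := VP x; exists i; rewrite inV xS ax eqxx orbT.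
- move=> x y xy; case: (boolP (x \in S)) => xS; case: (boolP (y \in S)) => yS /=;
    first by left; rewrite xy.
  + right; have [i [/(_ xS) xi _]] := VP x; exists i.
    by rewrite !inV yS -xi eqxx (att_nbr y x) ?eqxx ?orbT // e_sym.
  + right; have [i [/(_ yS) yi _]] := VP y; exists i.
    by rewrite !inV xS -yi eqxx (att_nbr x y) ?eqxx ?orbT // e_sym.
  + right; have [i [_ /(_ xS) xi]] := VP x; exists i.
    by rewrite !inV xS yS -(att_eq x y) // xi eqxx !orbT.
- apply: leq_trans leS.
  have VS i : #|V i :\: S| = \sum_(x in ~: S) (att x == enum_val i).
    rewrite -sum1_card big_mkcond [RHS]big_mkcond /=; apply: eq_bigr => x _.
    rewrite in_setD inV in_setC; case: (boolP (x \in S)) => //= xS.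
    have -> : x == enum_val i = false by apply: contraNF xS => /eqP->.
    by case: eqP.
  under eq_bigr do rewrite VS.
  rewrite exchange_big /= -[leqRHS]sum1_card; apply: leq_sum => x _.
  rewrite (bigD1 (enum_rank_in (attS x) (att x))) //= big1 ?addn0 ?leq_b1 // => i ni.
  by apply/eqP; rewrite eqb0; apply: contraNneq ni => ai;
    apply/eqP/enum_val_inj; rewrite enum_rankK_in.
Qed.

End Ears.

(** * Edge counting *)

Section Arithmetic.
Implicit Types (a b s t n r k q j E M D Q : nat).

Lemma quarter_sqS s : s.+1 ^ 2 %/ 4 = s ^ 2 %/ 4 + s.+1./2.
Proof.
rewrite -(odd_double_half s); case: (odd s); set m := s./2; rewrite -mul2n /=.
  have -> : (1 + 2 * m).+1 ^ 2 = (m * m + 2 * m + 1) * 4 by nia.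
  have -> : (1 + 2 * m) ^ 2 = (m * m + m) * 4 + 1 by nia.
  by rewrite divnMDl // mulnK //; lia.
have -> : (0 + 2 * m).+1 ^ 2 = (m * m + m) * 4 + 1 by nia.
have -> : (0 + 2 * m) ^ 2 = m * m * 4 by nia.
by rewrite divnMDl // mulnK //; lia.
Qed.

Lemma leq_mul_quarter_sq a b : a * b <= (a + b) ^ 2 %/ 4.
Proof. by rewrite leq_divRL // mulnC; apply: (nat_AGM2 a b). Qed.

(** Equality forces [(b - a) ^ 2 < 4], so [a] and [b] differ by at most one. *)
Lemma quarter_sq_half a b : a * b = (a + b) ^ 2 %/ 4 -> a <= b -> a = (a + b)./2.
Proof.
move=> ab leab; have : (a + b) ^ 2 < 4 * (a * b) + 4.
  by rewrite ab {1}(divn_eq ((a + b) ^ 2) 4) mulnC ltn_add2l ltn_mod.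
have -> : b = a + (b - a) by rewrite subnKC.
move: (b - a) => d lt; have : d * d < 4 by nia.
by case: d {lt} => [|[|d]]; [lia|lia|nia].
Qed.

(* Each of [t] outside vertices that joins the bipartite part is worth more than
   the [q + 2] edges it may have to that part and its edges to the outside. *)
Lemma quarter_sq_bin_shift q j t s : q + 2 + (j + t) <= s.+1./2 ->
  s ^ 2 %/ 4 + 'C(j + t, 2) + t * (q + 2) <= (s + t) ^ 2 %/ 4 + 'C(j, 2).
Proof.
elim: t s => [|t IH] s; first by rewrite !addn0.
move=> le; have {IH} := IH s.+1; rewrite quarter_sqS.
have -> : 'C(j + t.+1, 2) = 'C(j + t, 2) + (j + t) by rewrite addnS binS bin1.
have -> : s + t.+1 = s.+1 + t by rewrite addnS addSn.
rewrite mulSn; move: ('C(_, _)) (_ %/ 4) (_ %/ 4) ('C(_, _)) (t * _) le.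
by clear; lia.
Qed.

(** [E] counts ordered pairs. As [r <= n / 50], [(n - r + 1) ^ 2 / 2] exceeds [0.48 n ^ 2], and
    ['C(r, 2) >= 3] absorbs the roundings. *)
Lemma edge_bound_dense n r k E : 3 <= r -> r <= 2 * k -> 100 * k <= n ->
  (n - r + 1) ^ 2 %/ 4 + 'C(r, 2) <= E %/ 2 -> 384 * (n * n) <= 800 * E.
Proof.
move=> r3 rk kn le.
have := leq_trunc_div E 2; have := ltn_ceil ((n - r + 1) ^ 2) (isT : 0 < 4).
have : 3 <= 'C(r, 2) by rewrite (@leq_bin2l 3 r 2).
set f := _ %/ 4 in le *; set g := E %/ 2 in le *; move: 'C(r, 2) le => b le b3.
by move=> lt1 lt2; nia.
Qed.

(** The hypotheses give [0.84 n ^ 2 < 5 s ^ 2], so [s > 0.4 n]. The value [32 * k + 13] is what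
    [no_short_odd_cycle] needs with degrees [(6 * s - 3) / 16]. *)
Lemma dense_card_lower s n k E M : 2 <= k -> 100 * k <= n ->
  384 * (n * n) <= 800 * E -> 8 * E + 3 * (s * s) <= 8 * M + 3 * (n * n) ->
  M <= s * s.-1 -> 32 * k + 13 <= s.
Proof. by move=> *; nia. Qed.

(** For a bipartite set, [0.84 n ^ 2 <= s ^ 2]. The conclusion says [n - s <= s / 8 - 4], which
    keeps [3 s / 8 + (n - s)] below [s / 2]. *)
Lemma dense_bip_card_lower s n k E M : 2 <= k -> 100 * k <= n ->
  384 * (n * n) <= 800 * E -> 8 * E + 3 * (s * s) <= 8 * M + 3 * (n * n) ->
  2 * M <= s * s -> 8 * n + 32 <= 9 * s.
Proof. by move=> *; nia. Qed.

End Arithmetic.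

Section EdgeCounting.
Variables (T : finType) (e : rel T).
Hypotheses (e_sym : symmetric e) (e_irr : irreflexive e).
Implicit Types (S A B X Y : {set T}) (x y u v : T) (c : T -> bool).
Local Notation nbr := (nbr e).

(** Ordered pairs are counted: [adj_pairs A A] is twice the number of edges inside [A]. *)
Definition adj_pairs A B := \sum_(x in A) #|nbr B x|.

Lemma card_nbr B x : #|nbr B x| = \sum_(y in B) e x y.
Proof.
rewrite -sum1_card big_mkcond [RHS]big_mkcond; apply: eq_bigr => y _.
by rewrite in_nbr; case: (y \in B); case: (e x y).
Qed.

Lemma adj_pairsC A B : adj_pairs A B = adj_pairs B A.
Proof.
rewrite /adj_pairs; under eq_bigr do rewrite card_nbr.
rewrite exchange_big; apply: eq_bigr => y _; rewrite card_nbr.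
by apply: eq_bigr => x _; rewrite e_sym.
Qed.

Lemma card_nbrU A B x : [disjoint A & B] -> #|nbr (A :|: B) x| = #|nbr A x| + #|nbr B x|.
Proof.
by move=> dAB; rewrite !card_nbr -bigU //; apply: eq_bigl => y; rewrite !inE.
Qed.

Lemma adj_pairsUl A B X : [disjoint A & B] -> adj_pairs (A :|: B) X = adj_pairs A X + adj_pairs B X.
Proof.
by move=> dAB; rewrite /adj_pairs -bigU //; apply: eq_bigl => y; rewrite !inE.
Qed.

Lemma adj_pairsU A B : [disjoint A & B] ->
  adj_pairs (A :|: B) (A :|: B) = adj_pairs A A + 2 * adj_pairs B A + adj_pairs B B.
Proof.
move=> dAB; rewrite adj_pairsUl // ![adj_pairs _ (A :|: B)]adj_pairsC !adj_pairsUl //.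
by rewrite [adj_pairs A B]adj_pairsC; lia.
Qed.

Lemma adj_pairs1l x A : adj_pairs [set x] A = #|nbr A x|.
Proof. by rewrite /adj_pairs big_set1. Qed.

Lemma adj_pairs11 x : adj_pairs [set x] [set x] = 0.
Proof. by rewrite adj_pairs1l card_nbr big_set1 e_irr. Qed.

Lemma adj_pairsT : #|[set p : T * T | e p.1 p.2]| = adj_pairs setT setT.
Proof.
rewrite -sum1_card big_mkcond /= /adj_pairs.
under [RHS]eq_bigr do rewrite card_nbr.
rewrite pair_big /=; apply: eq_big => [[x y]|[x y] _]; rewrite !inE //.
Qed.

Lemma adj_pairs_self A : adj_pairs A A <= #|A| * #|A|.-1.
Proof.
rewrite -sum_nat_const; apply: leq_sum => x xA.
have -> : #|A|.-1 = #|A :\ x| by rewrite (cardsD1 x A) xA.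
apply: subset_leq_card; apply/subsetP => y; rewrite in_nbr => /andP[yA xy].
by rewrite in_setD1 yA eq_sym (adj_neq e_irr xy).
Qed.

Lemma leq_adj_pairs A B : adj_pairs A B <= #|A| * #|B|.
Proof.
by rewrite -sum_nat_const; apply: leq_sum => x _; apply: subset_leq_card; apply: nbr_sub.
Qed.

Lemma adj_pairs_nonadj A B X Y : X \subset A -> Y \subset B ->
  (forall x y, x \in X -> y \in Y -> ~~ e x y) ->
  adj_pairs A B + #|X| * #|Y| <= #|A| * #|B|.
Proof.
move=> XA YB noe.
have dX : [disjoint X & A :\: X].
  by apply/pred0P => t; rewrite /= in_setD; case: (t \in X).
have EA : A = X :|: (A :\: X) by rewrite -{1}(setIidPr XA) setID.
have -> : #|A| = #|X| + #|A :\: X| by rewrite cardsDS // subnKC // subset_leq_card.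
rewrite {1}EA adj_pairsUl // mulnDl addnAC leq_add ?leq_adj_pairs //.
rewrite /adj_pairs -!sum_nat_const -big_split /=; apply: leq_sum => x xX.
have -> : #|B| = #|B :\: Y| + #|Y| by rewrite cardsDS // subnK // subset_leq_card.
rewrite leq_add2r; apply: subset_leq_card; apply/subsetP => y.
rewrite in_nbr in_setD => /andP[-> xy]; rewrite andbT.
by apply: contraL xy => yY; apply: noe.
Qed.

Lemma adj_pairs_self_nonadj A x y : x \in A -> y \in A -> x != y -> ~~ e x y ->
  adj_pairs A A + 2 <= #|A| * #|A|.-1.
Proof.
move=> xA yA nxy nexy.
have half : forall x y, x \in A -> y \in A -> x != y -> ~~ e x y ->
    #|nbr A x|.+1 <= #|A|.-1.
  move=> {x y xA yA nxy nexy} x y xA yA nxy nexy.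
  have -> : #|A|.-1 = #|A :\ x| by rewrite (cardsD1 x A) xA.
  apply: proper_card; rewrite properE; apply/andP; split.
    apply/subsetP => t; rewrite in_nbr => /andP[tA xt].
    by rewrite in_setD1 tA eq_sym (adj_neq e_irr xt).
  by apply/subsetPn; exists y; rewrite ?in_setD1 ?in_nbr ?yA ?(negbTE nexy) // eq_sym nxy.
have hx := half _ _ xA yA nxy nexy.
have hy : #|nbr A y|.+1 <= #|A|.-1.
  by apply: (half y x) => //; rewrite 1?eq_sym // e_sym.
have rest : \sum_(t in (A :\ x) :\ y) #|nbr A t| <= #|(A :\ x) :\ y| * #|A|.-1.
  rewrite -sum_nat_const; apply: leq_sum => t; rewrite !in_setD1 => /and3P[_ _ tA].
  have -> : #|A|.-1 = #|A :\ t| by rewrite (cardsD1 t A) tA.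
  apply: subset_leq_card; apply/subsetP => s; rewrite in_nbr => /andP[sA ts].
  by rewrite in_setD1 sA eq_sym (adj_neq e_irr ts).
have yAx : y \in A :\ x by rewrite in_setD1 yA eq_sym nxy.
rewrite /adj_pairs (big_setD1 x xA) (big_setD1 y yAx) /=.
have cA : #|A| = #|(A :\ x) :\ y|.+2.
  by rewrite (cardsD1 x A) xA (cardsD1 y (A :\ x)) yAx.
move: hx hy rest; rewrite cA /=; move: #|_ :\ y| (\sum_(_ in _) _) #|nbr _ _| #|nbr _ _|.
by clear => a g p q; nia.
Qed.

Lemma adj_pairs_bip c S : proper_col e c S ->
  adj_pairs S S = 2 * adj_pairs (S :&: [set x | c x]) (S :\: [set x | c x]).
Proof.
move=> pr; set X := _ :&: _; set Y := _ :\: _.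
have no0 A : (forall x y, x \in A -> y \in A -> e x y = false) -> adj_pairs A A = 0.
  by move=> no; apply: big1 => x xA; rewrite card_nbr big1 // => y yA; rewrite no.
have -> : S = X :|: Y by rewrite setID.
rewrite adj_pairsU; last first.
  by apply/pred0P => t; rewrite /= !inE; case: (c t); rewrite ?andbF.
rewrite !no0 ?addn0 ?add0n 1?adj_pairsC // => x y; rewrite !inE => /andP[xS cx] /andP[yS cy];
  apply/negP => xy.
- by move: (pr _ _ cx cy xy); rewrite (negbTE xS) (negbTE yS).
- by move: (pr _ _ xS yS xy); rewrite cx cy.
Qed.

(* Optimality of [S] for [8 * adj_pairs S S - 3 * #|S| ^ 2] is tested on [setT],
   and on the removal or addition of one vertex. *)
Lemma dense_core : exists S,
  [/\ 8 * adj_pairs setT setT + 3 * (#|S| * #|S|) <= 8 * adj_pairs S S + 3 * (#|T| * #|T|),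
      forall x, x \in S -> 6 * #|S| <= 16 * #|nbr S x| + 3
    & forall x, x \notin S -> 16 * #|nbr S x| <= 6 * #|S| + 3].
Proof.
(* The added constant [3 * #|T| ^ 2] keeps the maximized quantity in the natural numbers without
   truncation. *)
pose phi A := 8 * adj_pairs A A + 3 * (#|T| * #|T| - #|A| * #|A|).
case: (@arg_maxnP _ setT xpredT phi isT) => S _ maxS.
have opt A : 8 * adj_pairs A A + 3 * (#|S| * #|S|) <= 8 * adj_pairs S S + 3 * (#|A| * #|A|).
  have := maxS A isT; rewrite /phi.
  have leT B : #|B| * #|B| <= #|T| * #|T| by rewrite leq_mul ?max_card.
  by move: (leT A) (leT S); clear; lia.
exists S; split.
- by have := opt setT; rewrite cardsT.
- move=> x xS; have := opt (S :\ x).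
  have dj : [disjoint S :\ x & [set x]] by rewrite disjoint_sym disjoints1 in_setD1 eqxx.
  have ES : S = (S :\ x) :|: [set x] by rewrite setUC setD1K.
  have := adj_pairsU dj; rewrite -ES adj_pairs11 adj_pairs1l => ->.
  have -> : #|nbr (S :\ x) x| = #|nbr S x|.
    by rewrite {2}ES card_nbrU // [#|nbr [set x] x|]card_nbr big_set1 e_irr addn0.
  by rewrite (cardsD1 x S) xS; clear; nia.
- move=> x xS; have := opt (S :|: [set x]).
  have dj : [disjoint S & [set x]] by rewrite disjoint_sym disjoints1.
  rewrite adj_pairsU // adj_pairs11 adj_pairs1l setUC cardsU1 xS.
  by clear; nia.
Qed.

End EdgeCounting.

(** * Shortest ears of wrong parity *)

Section MinimalBadEar.
Variables (T : finType) (e : rel T).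
Hypotheses (e_sym : symmetric e) (e_irr : irreflexive e).
Implicit Types (S A B X Y : {set T}) (x y z u v b : T) (c : T -> bool) (p : seq T).
Local Notation nbr := (nbr e).

(** This cut and the next one turn a neighbour [b] of an inner vertex [z] into two ears, from [u] to
    [b] and from [b] to [v]. *)
Lemma ear_left S u v z b p1 p2 : ear e S u v (p1 ++ z :: p2) -> b \in nbr S z -> b != u ->
  ear e S u b (p1 ++ [:: z]).
Proof.
case/and5P=> uS vS nuv; rewrite link_cat => /andP[l1 _] /andP[+ +].
rewrite cat_uniq all_cat /= => /and3P[U1 /norP[n1 _] _] /and3P[a1 az _].
rewrite in_nbr => /andP[bS zb] nbu.
by rewrite /ear uS bS eq_sym nbu link_cat l1 cat_uniq all_cat /= zb U1 (negbTE n1) a1 az.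
Qed.

Lemma ear_right S u v z b p1 p2 : ear e S u v (p1 ++ z :: p2) -> b \in nbr S z -> b != v ->
  ear e S b v (z :: p2).
Proof.
case/and5P=> uS vS nuv; rewrite link_cat => /andP[_ l2] /andP[+ +].
rewrite cat_uniq all_cat /= => /and3P[_ _ U2] /and3P[_ az a2].
rewrite in_nbr => /andP[bS zb] nbv.
by rewrite /ear bS vS nbv /= e_sym zb l2 U2 az a2.
Qed.

Lemma ear_single S u v z : z \notin S -> u \in nbr S z -> v \in nbr S z -> u != v ->
  ear e S u v [:: z].
Proof.
move=> zS; rewrite !in_nbr => /andP[uS zu] /andP[vS zv] nuv.
by rewrite /ear uS vS nuv /= e_sym zu zv zS.
Qed.

(* In a shortest ear of wrong parity, a neighbour in [S] of an inner vertex other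
   than the two ends splits the ear into two shorter ones, one of which has wrong
   parity. *)
Section Inner.
Variables (S : {set T}) (c : T -> bool) (u v z : T) (p1 p2 : seq T).
Local Notation p := (p1 ++ z :: p2).
Hypothesis smaller : forall u v q, size q < size p -> ear e S u v q -> ear_ok c u v q.
Hypotheses (E : ear e S u v p) (bad : ~ ear_ok c u v p).
Hypotheses (p10 : 0 < size p1) (p20 : 0 < size p2).

Lemma inner_nbr b : b \in nbr S z -> b = u \/ b = v.
Proof.
move=> bz; have [->|nbu] := eqVneq b u; first by left.
have [->|nbv] := eqVneq b v; first by right.
have := smaller _ (ear_left E bz nbu); have := smaller _ (ear_right E bz nbv).
rewrite /ear_ok !size_cat /= => H1 H2; case: bad; rewrite /ear_ok size_cat /=.
have {H1} := H1 _; rewrite -[X in X < _]add0n ltn_add2r p10 => /(_ isT).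
have {H2} := H2 _; rewrite ltn_add2l ltnS p20 => /(_ isT).
rewrite !addnS /= !addn0 !oddD.
by case: (c u); case: (c v); case: (c b); case: odd; case: odd.
Qed.

(** Two neighbours of [z] would be [u] and [v] themselves. The ears from [u] to [v] through [z]
    alone, through [p1] and [z], and through [z] and [p2] are shorter, and their parities make that
    of [p] right. *)
Lemma inner_card_nbr : #|nbr S z| <= 1.
Proof.
have zS : z \notin S by case/and5P: E => _ _ _ _ /andP[_ /allP]; apply;
  rewrite mem_cat mem_head orbT.
have nuv : u != v by case/and5P: E.
apply/card_le1P => a az b; rewrite [RHS]inE.
have [bz|bz] := boolP (b \in nbr S z); last by apply/esym/negbTE; apply: contraNneq bz => ->.
case: (eqVneq b a) => // nba; case: bad.
have [uz vz] : u \in nbr S z /\ v \in nbr S z.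
  have Ha := inner_nbr az; have Hb := inner_nbr bz.
  by case: Ha Hb az bz nba => -> [] ->; rewrite ?eqxx.
have lt1 : size [:: z] < size p by rewrite size_cat /=; move: p10; clear; lia.
have := smaller _ (ear_single zS uz vz nuv) => /(_ lt1).
have nvu : v != u by rewrite eq_sym.
have := smaller _ (ear_left E vz nvu); have := smaller _ (ear_right E uz nuv).
rewrite /ear_ok !size_cat /= => H1 H2.
have {H1} := H1 _; rewrite -[X in X < _]add0n ltn_add2r p10 => /(_ isT).
have {H2} := H2 _; rewrite ltn_add2l ltnS p20 => /(_ isT).
rewrite !addnS /= !addn0 !oddD.
by case: (c u); case: (c v); case: odd; case: odd.
Qed.

End Inner.
End MinimalBadEar.

(** * The bipartite core *)

Section Core.
Variables (T : finType) (e : rel T).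
Hypotheses (e_sym : symmetric e) (e_irr : irreflexive e).
Variables (k r : nat) (S : {set T}) (c : T -> bool).
Local Notation nbr := (nbr e).
Local Notation n := #|T|.
Local Notation X := (S :&: [set x | c x]).
Local Notation Y := (S :\: [set x | c x]).
(** [f] is the required number of edges; [q] bounds the degree into [S] of an outside vertex. *)
Local Notation f := ((n - r + 1) ^ 2 %/ 4 + 'C(r, 2)).
Local Notation q := ((6 * #|S| + 3) %/ 16).

Hypotheses (k2 : 2 <= k) (r3 : 3 <= r) (rk : r <= 2 * k) (kn : 100 * k <= n).
Hypothesis nocyc : forall s : seq T, uniq s -> cycle e s -> size s <> (2 * k).+1.
Hypothesis pr : proper_col e c S.
Hypothesis deg_in : forall x, x \in S -> 6 * #|S| <= 16 * #|nbr S x| + 3.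
Hypothesis deg_out : forall x, x \notin S -> 16 * #|nbr S x| <= 6 * #|S| + 3.
Hypothesis S_big : 8 * n + 32 <= 9 * #|S|.
Hypothesis edges : 2 * f <= adj_pairs e setT setT.

Definition pendant := [set x in ~: S | #|nbr S x| <= 1].
Definition attached := ~: S :\: pendant.

Local Lemma core_short_ear u v p : ear e S u v p -> size p < (2 * k).-1 -> ear_ok c u v p.
Proof.
(* This constant is the bound [(6 * #|S| - 3) / 16] of [deg_in], rounded up. *)
apply: (@short_ear_ok _ e e_sym S c ((6 * #|S| + 12) %/ 16)) => //.
- by move=> x /deg_in; clear; lia.
- by move: S_big kn k2; clear; lia.
- by move: S_big kn k2; clear; lia.
Qed.

Lemma card_outside : #|pendant| + #|attached| + #|S| = n.
Proof.
have sub : pendant \subset ~: S by apply/subsetP => x; rewrite inE => /andP[].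
by rewrite /attached cardsDS // subnKC ?subset_leq_card // addnC cardsC.
Qed.

Lemma total_bound :
  f * 2 <= 2 * adj_pairs e X Y + 2 * adj_pairs e (~: S) S + adj_pairs e (~: S) (~: S).
Proof.
rewrite mulnC; apply: leq_trans edges _.
by rewrite -(setUCr S) adj_pairsU ?(adj_pairs_bip e_sym pr) // -setI_eq0 setICr.
Qed.

Lemma card_sides : #|X| + #|Y| = #|S|.
Proof. by rewrite cardsID. Qed.

(** Degrees of the vertices in [P] are kept exact: [P] is empty when pendant vertices are counted,
    and consists of the first and last inner vertices when a wrong ear is excluded. *)
Lemma adj_outside (P : {set T}) : P \subset ~: S ->
  adj_pairs e (~: S) S <= adj_pairs e P S +
    (\sum_(x in pendant :\: P) #|nbr S x| + q * #|attached :\: P|).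
Proof.
move=> PS; have split_setD (A B : {set T}) : B \subset A ->
    adj_pairs e A S = adj_pairs e B S + adj_pairs e (A :\: B) S.
  move=> BA; rewrite -adj_pairsUl; last by apply/pred0P => t; rewrite /= in_setD; case: (t \in B).
  by rewrite -{1}(setIidPr BA) setID.
rewrite (split_setD _ _ PS) leq_add2l.
rewrite (split_setD (~: S :\: P) (pendant :\: P)); last first.
  by apply: setSD; apply/subsetP => x; rewrite inE => /andP[].
rewrite leq_add2l mulnC -sum_nat_const.
have -> : (~: S :\: P) :\: (pendant :\: P) = attached :\: P.
  by apply/setP => x; rewrite !in_setD; case: (x \in P); case: (x \in pendant).
apply: leq_sum => x; rewrite !in_setD in_setC => /and3P[_ _ xS].
by have := deg_out xS; clear; lia.
Qed.

Lemma sum_pendant (P : {set T}) : \sum_(x in pendant :\: P) #|nbr S x| <= #|pendant :\: P|.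
Proof.
rewrite -sum1_card; apply: leq_sum => x.
by rewrite in_setD inE => /andP[_ /andP[]].
Qed.

(** This is the premise of [quarter_sq_bin_shift]: [q] is about [3 * #|S| / 8], and [w] is below
    [#|S| / 8] by [S_big]. *)
Lemma q_bound w : w + #|S| = n -> q + 2 + w <= #|S|.+1./2.
Proof. by move: S_big; clear; lia. Qed.

(** Neighbours of different colours would be the ends of a wrong ear with the single inner vertex
    [z]. *)
Lemma out_color z a b : z \notin S -> a \in nbr S z -> b \in nbr S z -> c a = c b.
Proof.
move=> zS az bz; case: (eqVneq a b) => [->//|nab].
have := core_short_ear (ear_single e_sym zS az bz nab); rewrite /ear_ok /=.
have -> : 1 < (2 * k).-1 by move: k2; clear; lia.
by move=> /(_ isT); case: (c a); case: (c b).
Qed.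

Lemma color_class_card (b : {set T}) a0 : b \subset S -> (forall a, a \in b -> c a = a0) ->
  #|b| <= if a0 then #|X| else #|Y|.
Proof.
move=> bS ba; case: a0 ba => ba; apply: subset_leq_card; apply/subsetP => a ab;
  by rewrite !inE (ba _ ab) (subsetP bS).
Qed.

(** * Excluding ears of wrong parity when few vertices are pendant *)

Section BadEar.
Variables (u v x y : T) (mid : seq T).
Local Notation p := (x :: rcons mid y).
Hypothesis pend_small : #|pendant| <= r - 2.
Hypothesis smaller : forall u v q, size q < size p -> ear e S u v q -> ear_ok c u v q.
Hypothesis E : ear e S u v p.
Hypothesis bad : ~ ear_ok c u v p.
Local Notation P := [set x; y].

Local Lemma long_p : (2 * k).-1 <= size p.
Proof. by rewrite leqNgt; apply/negP => /(core_short_ear E). Qed.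

Local Lemma out_p z : z \in p -> z \notin S.
Proof. by case/and5P: E => _ _ _ _ /andP[_ /allP pS] /pS. Qed.

Local Lemma outx : x \notin S. Proof. by apply: out_p; rewrite mem_head. Qed.
Local Lemma outy : y \notin S.
Proof. by apply: out_p; rewrite in_cons mem_rcons mem_head orbT. Qed.

Local Lemma uniq_p : [&& x \notin mid, y \notin mid, x != y & uniq mid].
Proof.
case/and5P: E => _ _ _ _ /andP[+ _].
rewrite /= mem_rcons in_cons negb_or rcons_uniq.
by case/andP=> /andP[-> ->] /andP[-> ->].
Qed.

Local Lemma neq_xy : x != y. Proof. by case/and4P: uniq_p. Qed.

Local Lemma link_p : [/\ u \in nbr S x, v \in nbr S y & path e x (rcons mid y)].
Proof.
case/and5P: E => uS vS _; rewrite rcons_cons /= rcons_path last_rcons.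
case/and3P=> ux pth yv _.
by rewrite !in_nbr uS vS e_sym ux yv pth.
Qed.

(** All neighbours of [x] in [S] have one colour, and so have those of [y]; hence the ends can be
    exchanged without changing length or parity. *)
Local Lemma other_ends u' v' : u' \in nbr S x -> v' \in nbr S y ->
  u' != v' -> ear e S u' v' p /\ ~ ear_ok c u' v' p.
Proof.
move=> u'x v'y nuv; have [ux vy pth] := link_p.
split; last first.
  by rewrite /ear_ok (out_color outx u'x ux) (out_color outy v'y vy).
have /and5P[_ _ _ _ Up] := E.
move: u'x v'y; rewrite !in_nbr => /andP[u'S xu'] /andP[v'S yv'].
by rewrite /ear u'S v'S nuv Up /= e_sym xu' rcons_path pth last_rcons yv'.
Qed.

Local Lemma mid_split z : z \in mid -> exists p1 p2,
  [/\ p = p1 ++ z :: p2, 0 < size p1 & 0 < size p2].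
Proof.
case/path.splitPr => m1 m2; exists (x :: m1), (rcons m2 y).
by rewrite size_rcons rcons_cat.
Qed.

Local Lemma mid_nbr u' v' z b : u' \in nbr S x -> v' \in nbr S y -> u' != v' ->
  z \in mid -> b \in nbr S z -> b = u' \/ b = v'.
Proof.
move=> u'x v'y nuv /mid_split[p1 [p2 [Ep p10 p20]]] bz.
have [E' bad'] := other_ends u'x v'y nuv.
move: smaller E' bad'; rewrite Ep => sm E' bad'.
exact: (inner_nbr e_sym sm E' bad').
Qed.

Local Lemma mid_pendant : {subset mid <= pendant :\: P}.
Proof.
move=> z zm; have [p1 [p2 [Ep p10 p20]]] := mid_split zm.
have zS : z \notin S by apply: out_p; rewrite in_cons mem_rcons in_cons zm !orbT.
have := smaller; have := E; have := bad; rewrite Ep => bad' E' sm.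
rewrite in_setD in_set2 negb_or inE in_setC zS.
rewrite (inner_card_nbr e_sym sm E' bad') // !andbT.
have /and4P[xm ym _ _] := uniq_p.
by apply/andP; split; [apply: contraNneq xm => <-|apply: contraNneq ym => <-].
Qed.

Local Lemma size_mid : size mid <= #|pendant :\: P|.
Proof.
have /and4P[_ _ _ Um] := uniq_p.
rewrite -(card_uniqP Um); apply: subset_leq_card; apply/subsetP; exact: mid_pendant.
Qed.

Local Lemma P_out : P \subset ~: S.
Proof. by apply/subsetP => z; rewrite in_set2 in_setC => /orP[]/eqP->; rewrite ?outx ?outy. Qed.

Local Lemma card_P_out : #|pendant :\: P| + #|attached :\: P| + 2 + #|S| = n.
Proof.
have PO : #|~: S :\: P| + 2 = #|~: S|.
  rewrite cardsDS ?P_out // cards2 neq_xy subnK //.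
  by have := subset_leq_card P_out; rewrite cards2 neq_xy.
have -> : #|pendant :\: P| + #|attached :\: P| = #|~: S :\: P|.
  rewrite -(cardsID pendant (~: S :\: P)); congr (_ + _); apply: eq_card => z;
    rewrite !inE; case: (z == x); case: (z == y); case: (z \in S); case: (_ <= 1) => //.
by rewrite PO addnC cardsC.
Qed.

Local Lemma adj_pairs_P : adj_pairs e P S = #|nbr S x| + #|nbr S y|.
Proof.
rewrite /adj_pairs big_setU1 ?big_set1 //= in_set1; exact: neq_xy.
Qed.

Local Lemma notin_pendant z : z \notin S -> z \notin pendant -> 1 < #|nbr S z|.
Proof. by move=> zS; rewrite inE in_setC zS /= -ltnNge. Qed.

(* No edge joins the neighbourhoods of the two end vertices, which costs as many
   edges as these vertices contribute, up to one when one of them is pendant. *)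
Local Lemma bad_ear_odd : size p = (2 * k).-1 -> False.
Proof.
move=> szp; have [ux vy _] := link_p.
have cuv u' v' : u' \in nbr S x -> v' \in nbr S y -> c u' != c v'.
  move=> /(out_color outx ux) <- /(out_color outy vy) <-.
  move: (ear_okN bad); rewrite szp.
  have -> : odd (2 * k).-1 by move: k2; clear; lia.
  by case: (c u); case: (c v).
have nadj u' v' : u' \in nbr S x -> v' \in nbr S y -> ~~ e u' v'.
  move=> u'x v'y; have nuv : u' != v'.
    by apply: contraNneq (cuv _ _ u'x v'y) => ->.
  have [E' _] := other_ends u'x v'y nuv.
  by apply: (ear_nonadj e_sym nocyc _ E' szp); move: k2; clear; lia.
have M : adj_pairs e X Y + #|nbr S x| * #|nbr S y| <= #|X| * #|Y|.
  have side z b : b \in nbr S z -> b \in S by move/(subsetP (nbr_sub e S z)).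
  case cu : (c u).
    apply: adj_pairs_nonadj => //; apply/subsetP => b bz; rewrite !inE (side _ _ bz).
      by rewrite -(out_color outx ux bz) cu.
    by move: (cuv _ _ ux bz); rewrite cu; case: (c b).
  rewrite mulnC; apply: adj_pairs_nonadj.
  - apply/subsetP => b bz; rewrite !inE (side _ _ bz).
    by move: (cuv _ _ ux bz); rewrite cu; case: (c b).
  - by apply/subsetP => b bz; rewrite !inE (side _ _ bz) -(out_color outx ux bz) cu.
  - by move=> v' u' v'y u'x; rewrite e_sym; apply: nadj.
have d1 : 0 < #|nbr S x| by rewrite card_gt0; apply/set0Pn; exists u.
have d2 : 0 < #|nbr S y| by rewrite card_gt0; apply/set0Pn; exists v.
(* For positive degrees the sum is at most the product plus one; the extra one is paid by a pendant
   vertex of [P]. If there is none, both degrees are at least two. *)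
have dd : #|nbr S x| + #|nbr S y| + #|pendant :\: P| <= #|nbr S x| * #|nbr S y| + #|pendant|.
  have [Pp|] := boolP [exists z in P, z \in pendant].
    have lt : #|pendant :\: P| < #|pendant|.
      apply: proper_card; rewrite properE subsetDl /=.
      case/existsP: Pp => z /andP[zP zp]; apply/subsetPn; exists z => //.
      by rewrite in_setD zP.
    have dd1 : #|nbr S x| + #|nbr S y| <= (#|nbr S x| * #|nbr S y|).+1.
      by move: d1 d2; clear; case: #|_| => // a _; case: #|_| => // b _; nia.
    by move: dd1 lt; clear; lia.
  rewrite negb_exists => /forallP no.
  have npd z : z \in P -> z \notin pendant by move=> zP; move: (no z); rewrite zP.
  have x2 := notin_pendant outx (npd x (set21 _ _)).
  have y2 := notin_pendant outy (npd y (set22 _ _)).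
  have le : #|pendant :\: P| <= #|pendant| by apply: subset_leq_card; apply: subsetDl.
  have dd2 : #|nbr S x| + #|nbr S y| <= #|nbr S x| * #|nbr S y|.
    by move: x2 y2; clear; case: #|_| => [//|[//|a]] _; case: #|_| => [//|[//|b]] _; nia.
  by move: dd2 le; clear; lia.
have := adj_outside P_out; rewrite adj_pairs_P.
have := sum_pendant P.
have := adj_pairs_self e_irr (~: S).
have := total_bound; have := leq_mul_quarter_sq #|X| #|Y|; rewrite card_sides.
have cO : #|~: S| = #|pendant :\: P| + #|attached :\: P| + 2.
  by apply/eqP; rewrite -(eqn_add2r #|S|) card_P_out addnC cardsC.
have ltm := size_mid.
have szm : size mid + 2 = (2 * k).-1 by rewrite -szp /= size_rcons addn2.
set wP := #|pendant :\: P| in dd cO ltm *; set zP := #|attached :\: P| in cO *.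
(* The [t] outside vertices beyond [r - 1] are counted as if moved to the bipartite part, since
   [#|S| + t = n - r + 1]. *)
pose t := wP + zP + 2 - (r - 1).
have Ew : wP + zP + 2 = (r - 1) + t by rewrite subnKC //; move: ltm szm rk k2; clear; lia.
have qb := @q_bound (wP + zP + 2) card_P_out.
rewrite Ew in qb.
have shift := quarter_sq_bin_shift qb.
have Est : #|S| + t = n - r + 1.
  by move: card_P_out Ew r3 kn rk k2; rewrite -/wP -/zP; clear; lia.
have zt : q * zP <= t * (q + 2).
  by rewrite mulnC leq_mul ?leq_addr //; move: ltm szm rk k2 Ew; clear; lia.
(* The summand [r - 1] exceeds [#|pendant|], which yields the contradiction. *)
have b1 : 'C(r, 2) = 'C(r - 1, 2) + (r - 1).
  by rewrite -{1}(subnK (ltnW (ltnW r3))) addn1 binS bin1.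
rewrite cO Ew Est in shift *.
have b2 : (r - 1 + t) * (r - 1 + t).-1 = 2 * 'C(r - 1 + t, 2).
  by rewrite -mul_bin_diag bin1.
move: shift zt b1 b2 dd M pend_small r3; clear.
move: (_ ^ 2 %/ 4) (_ ^ 2 %/ 4) => F1 F2; move: 'C(_, _) 'C(_, _) 'C(_, _) => B1 B2 B3.
move: (#|X| * #|Y|) (#|nbr S x| * #|nbr S y|) (q * zP) (t * _) (_ * _.-1).
move: (adj_pairs e X Y) (adj_pairs e _ S) (adj_pairs e _ _) (\sum_(_ in _) _).
by lia.
Qed.

(* Here [r = 2 * k], the inner vertices are all the pendant ones and have no
   neighbour in [S], and the neighbourhoods of the two end vertices are disjoint
   on one side: these two vertices together count for at most one. *)
Local Lemma bad_ear_even : 2 * k <= size p -> False.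
Proof.
move=> lep; have [ux vy pth] := link_p.
have sm := size_mid; have szm : size mid + 2 = size p by rewrite /= size_rcons addn2.
have lePp : #|pendant :\: P| <= #|pendant| by apply: subset_leq_card; apply: subsetDl.
(* The chain [2 * k - 2 <= size mid <= #|pendant :\: P| <= #|pendant| <= r - 2 <= 2 * k - 2] is
   tight. *)
have [szp rE wE wP] : [/\ size p = 2 * k, r = 2 * k, #|pendant| = r - 2
    & #|pendant :\: P| = size mid].
  by split; move: lep sm szm lePp pend_small rk k2; clear; lia.
have npd z : z \in P -> z \notin pendant.
  move=> zP; apply/negP => zp.
  have : #|pendant :\: P| < #|pendant|.
    apply: proper_card; rewrite properE subsetDl /=; apply/subsetPn; exists z => //.
    by rewrite in_setD zP.
  by rewrite wP wE; move: szm szp rE; clear; lia.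
have x2 := notin_pendant outx (npd x (set21 _ _)).
have y2 := notin_pendant outy (npd y (set22 _ _)).
have cuv : c u = c v.
  move: (ear_okN bad); rewrite szp mul2n odd_double.
  by case: (c u); case: (c v).
have /and5P[_ _ _ _ /andP[Up /allP pS]] := E.
(* A common neighbour would close the [2 * k] inner vertices to a [C_{2k+1}]. *)
have dis : [disjoint nbr S x & nbr S y].
  apply/pred0P => b /=; apply/negP; rewrite !in_nbr => /andP[/andP[bS xb] /andP[_ yb]].
  apply: (@nocyc (b :: p)); last by rewrite [size _]/= -[(size _).+1]/(size p) szp.
    by rewrite cons_uniq Up andbT; apply: contraL bS => /pS.
  by rewrite (cycle_path b) /= last_rcons yb e_sym xb pth.
have class : #|nbr S x| + #|nbr S y| <= if c u then #|X| else #|Y|.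
  rewrite -cardsUI; move: dis; rewrite -setI_eq0 => /eqP->; rewrite cards0 addn0.
  apply: color_class_card; first by rewrite subUset !nbr_sub.
  move=> b /setUP[bx|by_]; first exact: (out_color outx bx ux).
  by rewrite cuv; apply: (out_color outy by_ vy).
have mid0 z : z \in mid -> #|nbr S z| = 0.
  move=> zm; apply/eqP; rewrite cards_eq0; apply/eqP/setP => b; rewrite in_set0.
  apply/negP => bz.
  have other t : 1 < #|nbr S t| -> exists a, (a \in nbr S t) && (a != b).
    rewrite (cardsD1 b) => lt.
    have /set0Pn[a] : nbr S t :\ b != set0.
      by rewrite -card_gt0; move: lt; case: (_ \in _); case: #|_|.
    by rewrite in_setD1 => /andP[nab ant]; exists a; rewrite ant.
  (* Ends distinct from [b] contradict [mid_nbr]. *)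
  have [u' /andP[u'x nu'b]] := other _ x2; have [v' /andP[v'y nv'b]] := other _ y2.
  have nuv : u' != v'.
    apply: contraTneq v'y => <-; apply/negP => u'y.
    by move/pred0P/(_ u'): dis => /=; rewrite u'x u'y.
  by case: (mid_nbr u'x v'y nuv zm bz) => Eb; move: nu'b nv'b; rewrite Eb eqxx.
have sum0 : \sum_(z in pendant :\: P) #|nbr S z| = 0.
  apply: big1 => z zp; apply: mid0.
  have /and4P[_ _ _ Um] := uniq_p.
  have /eqP Em : [set z in mid] == pendant :\: P.
    have cm : #|[set z in mid]| = size mid by rewrite cardsE (card_uniqP Um).
    rewrite eqEcard cm wP leqnn andbT.
    by apply/subsetP => t; rewrite inE => /mid_pendant.
  by move: zp; rewrite -Em inE.
(* An edge here would give a wrong ear with two inner vertices. Its absence makes the final count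
   strict. *)
have nexy : ~~ e x y.
  apply/negP => exy.
  have E2 : ear e S u v [:: x; y].
    have /and5P[uS vS nuv _ _] := E; move: ux vy; rewrite !in_nbr => /andP[_ xu] /andP[_ yv].
    by rewrite /ear uS vS nuv /= e_sym xu exy yv in_cons orbF neq_xy outx outy.
  have := core_short_ear E2; rewrite /ear_ok cuv addbb /=.
  have -> : 2 < (2 * k).-1 by move: k2; clear; lia.
  by move=> /(_ isT).
have inO z : z \notin S -> z \in ~: S by rewrite in_setC.
have Qb := adj_pairs_self_nonadj e_sym e_irr (inO _ outx) (inO _ outy) neq_xy nexy.
have := adj_outside P_out; rewrite adj_pairs_P sum0.
have := total_bound; have := leq_adj_pairs e X Y.
(* Together [x] and [y] count for at most one vertex joined to a whole colour class, hence a product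
   on [#|S| + 1] vertices. *)
have FX : #|X| * #|Y| + (if c u then #|X| else #|Y|) <= #|S|.+1 ^ 2 %/ 4.
  rewrite -card_sides; case: (c u).
    by rewrite addnC -mulnS -addnS leq_mul_quarter_sq.
  by rewrite addnC -mulSn -addSn leq_mul_quarter_sq.
have cO : #|~: S| = #|pendant :\: P| + #|attached :\: P| + 2.
  by apply/eqP; rewrite -(eqn_add2r #|S|) card_P_out addnC cardsC.
set zP := #|attached :\: P| in cO *.
have cO' : #|~: S| = r + zP by move: cO wP szm szp rE; clear; lia.
have qb : q + 2 + (r + zP) <= #|S|.+2./2.
  have /q_bound : r + zP + #|S| = n by rewrite -cO' addnC cardsC.
  by clear; lia.
have shift := quarter_sq_bin_shift qb.
have Est : #|S|.+1 + zP = n - r + 1.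
  by move: (cardsC S) cO' kn rk k2; clear; lia.
have zt : q * zP <= zP * (q + 2) by rewrite mulnC leq_mul ?leq_addr.
rewrite Est in shift; rewrite cO' in Qb.
have b2 : (r + zP) * (r + zP).-1 = 2 * 'C(r + zP, 2) by rewrite -mul_bin_diag bin1.
rewrite b2 in Qb.
move: shift zt class FX Qb; clear.
move: (_ ^ 2 %/ 4) (_ ^ 2 %/ 4) => F1 F2; move: 'C(_, _) 'C(_, _) => B1 B2.
move: (#|X| * #|Y|) (q * zP) (zP * _) (if c u then _ else _).
move: (adj_pairs e X Y) (adj_pairs e _ S) (adj_pairs e _ _).
by lia.
Qed.

Local Lemma no_bad_ear : False.
Proof.
have := long_p; rewrite leq_eqVlt => /orP[/eqP Ep|lt]; first exact: bad_ear_odd.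
by apply: bad_ear_even; move: lt k2; clear; lia.
Qed.

End BadEar.

Lemma core_ears_ok : #|pendant| <= r - 2 -> ears_ok e c S.
Proof.
move=> le u v p; have [m] := ubnP (size p); elim: m u v p => // m IH u v p ltm E.
case: (eqVneq (c u (+) c v) (~~ odd (size p))) => // /eqP bad; exfalso.
have lp : (2 * k).-1 <= size p by rewrite leqNgt; apply/negP => /(core_short_ear E).
case: p ltm E bad lp => [|x p] ltm E bad lp; first by move: lp k2 => /=; clear; lia.
case/lastP: p ltm E bad lp => [|mid y] ltm E bad lp; first by move: lp k2 => /=; clear; lia.
apply: (no_bad_ear le _ E bad) => u' v' s lts; apply: IH.
by apply: leq_trans lts _.
Qed.

(* The number of edges is at most the required one, so every estimate is tight. *)
Lemma many_pendant : r - 1 <= #|pendant| ->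
  [/\ #|pendant| = r - 1, ~: S = pendant, adj_pairs e X Y = #|X| * #|Y|,
      #|X| * #|Y| = (n - r + 1) ^ 2 %/ 4
    & adj_pairs e (~: S) S = r - 1 /\ adj_pairs e (~: S) (~: S) = #|~: S| * #|~: S|.-1].
Proof.
move=> le.
pose t := #|pendant| + #|attached| - (r - 1).
have Ew : #|pendant| + #|attached| = (r - 1) + t.
  by rewrite subnKC // (leq_trans le) // leq_addr.
have cO : #|~: S| = r - 1 + t.
  by move: (cardsC S) card_outside Ew; clear; lia.
have A0 : adj_pairs e set0 S = 0 by rewrite /adj_pairs big_set0.
have := adj_outside (sub0set (~: S)); rewrite !setD0 A0 add0n.
have := sum_pendant set0; rewrite setD0.
have := adj_pairs_self e_irr (~: S).
have := total_bound; have := leq_mul_quarter_sq #|X| #|Y|; rewrite card_sides.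
have := leq_adj_pairs e X Y.
have qb := q_bound card_outside; rewrite Ew in qb.
have shift := quarter_sq_bin_shift qb.
have Est : #|S| + t = n - r + 1.
  by move: card_outside Ew r3 kn rk k2; clear; lia.
(* Each of the [t] surplus vertices is charged at most [q + 1], while the shift grants [q + 2]; the
   excess [t] must vanish. *)
have zt : (q + 1) * #|attached| + (#|pendant| - (r - 1)) * (q + 1) <= t * (q + 1).
  by rewrite mulnC -mulnDl leq_mul // /t; move: le; clear; lia.
have b1 : 'C(r, 2) = 'C(r - 1, 2) + (r - 1).
  by rewrite -{1}(subnK (ltnW (ltnW r3))) addn1 binS bin1.
have b2 : #|~: S| * #|~: S|.-1 = 2 * 'C(r - 1 + t, 2).
  by rewrite cO -mul_bin_diag bin1.
have wq : #|pendant| - (r - 1) <= (#|pendant| - (r - 1)) * (q + 1).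
  by rewrite leq_pmulr // addn1.
have z1 : (q + 1) * #|attached| = q * #|attached| + #|attached| by rewrite mulnDl mul1n.
have t1 : t * (q + 2) = t * (q + 1) + t by rewrite addnS mulnS addnC addn1.
rewrite b2 Est in shift *.
move=> h1 h2 h3 h4 h5 h6.
have t0 : t = 0.
  move: shift zt b1 wq z1 t1 h1 h2 h3 h4 h5 h6 le; clear.
  move: (_ ^ 2 %/ 4) (_ ^ 2 %/ 4) => F1 F2; move: 'C(_, _) 'C(_, _) 'C(_, _) => B1 B2 B3.
  move: (#|X| * #|Y|) ((q + 1) * _) (q * _) (t * (q + 1)) (t * (q + 2)) (_ * (q + 1)).
  move: (adj_pairs e X Y) (adj_pairs e _ S) (adj_pairs e _ _) (\sum_(_ in _) _).
  by lia.
have z0 : #|attached| = 0 by move: t0 le Ew; clear; lia.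
have w1 : #|pendant| = r - 1 by move: t0 z0 Ew; clear; lia.
move: shift h1 h2 h3 h4 h5 h6 b1 (Est) b2; rewrite t0 z0 w1 !(addn0, muln0, mul0n).
move=> shift h1 h2 h3 h4 h5 h6 b1 Es b2.
split=> //.
- apply/eqP; rewrite eq_sym eqEcard; apply/andP; split.
    by apply/subsetP => x; rewrite inE => /andP[].
  by rewrite cO t0 w1 addn0.
- by move: h1 h2 h3 h4 h5 h6 b1; rewrite -Es; clear; lia.
- by move: h1 h2 h3 h4 h5 h6 b1; rewrite -Es; clear; lia.
- by split; move: h1 h2 h3 h4 h5 h6 b1; rewrite -Es; clear; lia.
Qed.

Lemma in_Gnr_of_superset (S' : {set T}) c' : S \subset S' -> ears_ok e c' S' ->
  (forall u v p, ear e S' u v p -> p = [::]) -> #|~: S'| <= r - 2 -> in_Gnr e r.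
Proof.
move=> sub ok no le; apply: (in_Gnr_of_closed e_sym e_irr _ ok no le).
have : 0 < #|S| by move: S_big; clear; lia.
by rewrite card_gt0 => /set0Pn[a /(subsetP sub) aS']; apply/set0Pn; exists a.
Qed.

(** Outside the ear closure of [S] only pendant vertices remain, since a vertex with two neighbours
    in [S] would be an ear. *)
Lemma few_pendant : #|pendant| <= r - 2 -> in_Gnr e r.
Proof.
move=> le; have ok := core_ears_ok le.
have [S' [c' [sub ok' no]]] := ear_closure e_sym ok.
apply: (in_Gnr_of_superset sub ok' no); apply: leq_trans le; apply: subset_leq_card.
apply/subsetP => x; rewrite in_setC => xS'.
have xS : x \notin S by apply: contra xS' => /(subsetP sub).
apply: contraT => /(notin_pendant xS) /card_gt1P[a [b [ax bx nab]]].
have nbrS' : {subset nbr S x <= nbr S' x}.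
  by move=> t; rewrite !in_nbr => /andP[/(subsetP sub) -> ->].
by have := no _ _ _ (ear_single e_sym xS' (nbrS' _ ax) (nbrS' _ bx) nab).
Qed.

(** * The tight case of [r - 1] pendant vertices *)

Section Extremal.
Hypothesis le_pendant : r - 1 <= #|pendant|.

Local Lemma sides_complete x y : x \in X -> y \in Y -> e x y.
Proof.
move=> xX yY; have [_ _ XY _ _] := many_pendant le_pendant.
apply: contraT => nexy.
have := @adj_pairs_nonadj _ e X Y [set x] [set y].
rewrite !sub1set xX yY XY !cards1 addn1 ltnn => /(_ isT isT); apply.
by move=> x' y' /set1P-> /set1P->.
Qed.

Local Lemma outside_clique x y : x \notin S -> y \notin S -> x != y -> e x y.
Proof.
move=> xS yS nxy; have [_ _ _ _ [_ Q]] := many_pendant le_pendant.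
apply: contraT => nexy.
have := @adj_pairs_self_nonadj _ e e_sym e_irr (~: S) x y.
by rewrite !in_setC Q addn2 => /(_ xS yS nxy nexy); rewrite ltnNge leqW.
Qed.

(** The [r - 1] outside vertices have at most one neighbour each and send [r - 1] edges to [S], so
    none has degree zero. *)
Local Lemma outside_attach x : x \notin S -> exists a, nbr S x = [set a].
Proof.
move=> xS; have [w1 Ep _ _ [D _]] := many_pendant le_pendant.
apply/cards1P; rewrite eqn_leq.
have le1 z : z \in ~: S -> #|nbr S z| <= 1 by rewrite Ep inE => /andP[].
have xO : x \in ~: S by rewrite in_setC.
rewrite le1 //= lt0n; apply/negP => /eqP d0.
move: D; rewrite /adj_pairs (big_setD1 x xO) /= d0 add0n => D.
have : \sum_(z in ~: S :\ x) #|nbr S z| <= #|~: S :\ x|.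
  by rewrite -sum1_card; apply: leq_sum => z; rewrite in_setD1 => /andP[_]; apply: le1.
rewrite D; move: w1; rewrite -Ep (cardsD1 x) xO => <-.
by rewrite add1n ltnn.
Qed.

Local Lemma card_core : #|S| = n - r + 1.
Proof.
have [w1 Ep _ _ _] := many_pendant le_pendant.
by move: (cardsC S) kn rk k2 r3; rewrite Ep w1; clear; lia.
Qed.

Local Lemma clique_of_common_attach a :
  (forall x, x \notin S -> nbr S x = [set a]) -> a \in S ->
  bip_with_clique e (n - r + 1) r.
Proof.
move=> att aS; have [w1 Ep _ FXY _] := many_pendant le_pendant.
have inX t : (t \in X) = (t \in S) && c t by rewrite in_setI inE.
have inY t : (t \in Y) = (t \in S) && ~~ c t by rewrite in_setD inE andbC.
pose K := a |: ~: S.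
have inK t : (t \in K) = (t == a) || (t \notin S) by rewrite in_setU1 in_setC.
have adj x y : e x y = [|| (x \in X) && (y \in Y), (x \in Y) && (y \in X)
                         | [&& x \in K, y \in K & x != y]].
  rewrite !inK !inX !inY.
  have out t s : t \notin S -> s \in S -> e t s = (s == a).
    by move=> tS sS; have := in_nbr e S t s; rewrite sS att // in_set1.
  case: (boolP (x \in S)) => xS; case: (boolP (y \in S)) => yS /=; rewrite ?orbF ?orbT ?andbF //=.
  - have -> : [&& x == a, y == a & x != y] = false.
      by case: eqVneq => //= ->; rewrite eq_sym andbN.
    rewrite orbF; apply/idP/orP => [xy|].
      by have := pr xS yS xy; case: (c x); case: (c y) => //; [left|right].
    case=> /andP[cx cy]; last rewrite e_sym; apply: sides_complete; rewrite ?inX ?inY;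
      by rewrite ?xS ?yS.
  - have nxy : x != y by apply: contraTneq xS => ->.
    by rewrite e_sym out // nxy andbT.
  - have nxy : x != y by apply: contraTneq yS => <-.
    by rewrite out // nxy andbT.
  - by apply/idP/idP => [/(adj_neq e_irr)|]; [|apply: outside_clique].
have dXY : [disjoint X & Y].
  by apply/pred0P => t; rewrite /= inX inY; case: (c t); rewrite ?andbF.
have UXY : X :|: Y = S by rewrite setID.
have cK : #|K| = r.
  by rewrite cardsU1 in_setC aS Ep w1; move: r3; clear; lia.
have KS : #|K :&: S| = 1.
  apply/eqP/cards1P; exists a; apply/setP => t; rewrite in_setI inK in_set1.
  by case: eqVneq => [->|_] //=; case: (t \in S).
have KT : S :|: K = setT.
  by apply/setP => t; rewrite !inE; case: (t \in S); rewrite ?orbT.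
have cS := card_core; rewrite -cS -card_sides in FXY.
(* The smaller class must come first, as [bip_with_clique] gives it size [m./2]. *)
have [le|lt] := leqP #|X| #|Y|.
  exists X, Y, K; rewrite UXY; do !split => //.
  by rewrite (quarter_sq_half FXY le) card_sides cS.
exists Y, X, K; rewrite setUC UXY disjoint_sym; do !split => //.
  rewrite mulnC addnC in FXY.
  by rewrite (quarter_sq_half FXY (ltnW lt)) addnC card_sides cS.
by move=> x y; rewrite adj orbCA.
Qed.

(** The ear [x y] forces different colours on [a] and [b]. If [r > 3], a third outside vertex [z]
    gives the wrong ear [x z y]: it is too short, or [k = 2] and the edge [a b] closes a [C_5]. If
    [r = 3], every ear is short, and the ear closure absorbs [x]. *)
Local Lemma Gnr_of_two_attach x y a b : x \notin S -> y \notin S ->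
  a \in nbr S x -> b \in nbr S y -> a != b -> x != y -> in_Gnr e r.
Proof.
move=> xS yS ax yb nab nxy; have [w1 Ep _ _ _] := many_pendant le_pendant.
have xy := outside_clique xS yS nxy.
have mkear (S' : {set T}) q : S \subset S' -> path e x (rcons q y) -> uniq (x :: rcons q y) ->
    all (fun t => t \notin S') (x :: rcons q y) -> ear e S' a b (x :: rcons q y).
  move=> sub pth U aq; move: ax yb; rewrite !in_nbr => /andP[aS xa] /andP[bS yb].
  rewrite /ear (subsetP sub _ aS) (subsetP sub _ bS) nab U aq.
  by rewrite rcons_cons /= e_sym xa rcons_path pth last_rcons yb.
have E2 : ear e S a b [:: x; y].
  by apply: (mkear S [::]) => //=; rewrite ?xy ?in_cons ?orbF ?nxy ?xS ?yS.
have cab : c a != c b.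
  have := core_short_ear E2; rewrite /ear_ok /=.
  have -> : 2 < (2 * k).-1 by move: k2; clear; lia.
  by move=> /(_ isT); case: (c a); case: (c b).
have [r_gt|r_le] := ltnP 3 r.
  have [z] : exists z, z \in (~: S :\ x) :\ y.
    apply/set0Pn; rewrite -card_gt0.
    move: (cardsD1 x (~: S)) (cardsD1 y (~: S :\ x)) r_gt.
    by rewrite in_setD1 !in_setC xS yS eq_sym nxy Ep w1 /=; clear; lia.
  rewrite !in_setD1 in_setC => /and3P[nzy nzx zS].
  have E3 : ear e S a b [:: x; z; y].
    apply: (mkear S [:: z]) => //=; last by rewrite xS yS zS.
      by rewrite !outside_clique // eq_sym.
    by rewrite !in_cons !orbF negb_or nxy nzy eq_sym nzx.
  exfalso; have [lt|ge] := ltnP 3 (2 * k).-1.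
    by have := core_short_ear E3 lt; rewrite /ear_ok /=; move: cab; case: (c a); case: (c b).
  have k3 : size [:: x; z; y] = (2 * k).-1 by move: ge k2 => /=; clear; lia.
  have := ear_nonadj e_sym nocyc (ltnW k2) E3 k3; apply/negP; rewrite negbK.
  move: ax yb; rewrite !in_nbr => /andP[aS _] /andP[bS _].
  case ca : (c a) cab => cab; [|rewrite e_sym]; apply: sides_complete; rewrite !inE ?aS ?bS ?ca //.
  - by case: (c b) cab.
  - by case: (c b) cab.
have ok : ears_ok e c S.
  move=> u v p E; apply: core_short_ear (E) _.
  have /and5P[_ _ _ _ /andP[Up /allP pS]] := E.
  have : #|[set t in p]| <= #|~: S|.
    by apply: subset_leq_card; apply/subsetP => t; rewrite inE in_setC; apply: pS.
  by rewrite cardsE (card_uniqP Up) Ep w1; move: k2 r_le; clear; lia.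
have [S' [c' [sub ok' no]]] := ear_closure e_sym ok.
apply: (in_Gnr_of_superset sub ok' no).
(* Otherwise [x] is an ear from [a] to [y], or [x y] is an ear from [a] to [b]. *)
have xS' : x \in S'.
  apply: contraT => xS'; have [yS'|yS'] := boolP (y \in S').
    have nay : a != y by apply: contraNneq yS => <-; move: ax; rewrite in_nbr => /andP[].
    have ax' : a \in nbr S' x.
      by move: ax; rewrite !in_nbr => /andP[/(subsetP sub) -> ->].
    have yx' : y \in nbr S' x by rewrite in_nbr yS' xy.
    by have := no _ _ _ (ear_single e_sym xS' ax' yx' nay).
  have := mkear S' [::] sub; rewrite /= xy in_cons orbF nxy xS' yS'.
  by move=> /(_ isT isT isT) /no.
have : #|~: S'| <= #|~: S :\ x|.
  apply: subset_leq_card; apply/subsetP => t; rewrite in_setD1 !in_setC => tS'.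
  have -> : t \notin S by apply: contra tS' => /(subsetP sub).
  by rewrite andbT; apply: contraNneq tS' => ->.
move/leq_trans; apply; move: (cardsD1 x (~: S)).
by rewrite in_setC xS Ep w1 /=; clear; lia.
Qed.

Lemma extremal_structure : in_Gnr e r \/ bip_with_clique e (n - r + 1) r.
Proof.
have [w1 Ep _ _ _] := many_pendant le_pendant.
have /set0Pn[x] : ~: S != set0 by rewrite -card_gt0 Ep w1; move: r3; clear; lia.
rewrite in_setC => xS; have [a ax] := outside_attach xS.
have aN : a \in nbr S x by rewrite ax set11.
have [/forallP all|] := boolP [forall y, (y \notin S) ==> (a \in nbr S y)].
  right; apply: (@clique_of_common_attach a); last by move: aN; rewrite in_nbr => /andP[].
  move=> y yS; have [b by_] := outside_attach yS.
  by move: (all y); rewrite yS by_ /= => /set1P->.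
rewrite negb_forall => /existsP[y]; rewrite negb_imply => /andP[yS ay].
have [b by_] := outside_attach yS; left.
apply: (@Gnr_of_two_attach x y a b) => //; first by rewrite by_ set11.
- by apply: contraNneq ay => ->; rewrite by_ set11.
- by apply: contraNneq ay => <-.
Qed.

End Extremal.

Lemma core_structure : in_Gnr e r \/ bip_with_clique e (n - r + 1) r.
Proof.
have [le|lt] := leqP #|pendant| (r - 2); first by left; apply: few_pendant.
by apply: extremal_structure; move: lt r3; clear; lia.
Qed.

End Core.

Theorem theorem1p3 (k r n : nat) (T : finType) (e : rel T) :
  2 <= k -> 3 <= r -> r <= 2 * k -> 100 * k <= n ->
  #|T| = n -> simple_graph e ->
  ~ has_cycle e (2 * k).+1 ->
  (n - r + 1) ^ 2 %/ 4 + 'C(r, 2) <= edge_count e ->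
  in_Gnr e r \/ bip_with_clique e (n - r + 1) r.
Proof.
move=> k2 r3 rk kn nT [e_sym e_irr] nocyc0; rewrite -{}nT in kn * => le.
have nocyc s : uniq s -> cycle e s -> size s <> (2 * k).+1.
  by move=> Us cs szs; apply: nocyc0; rewrite -szs; apply: has_cycle_seq; rewrite ?szs.
have [S [opt deg_in deg_out]] := dense_core e_sym e_irr.
rewrite /edge_count adj_pairsT in le.
have dense := edge_bound_dense r3 rk kn le.
have s_low := dense_card_lower k2 kn dense opt (adj_pairs_self e_irr S).
have hS x : x \in S -> (6 * #|S| + 12) %/ 16 <= #|nbr e S x|.
  by move=> /deg_in; clear; lia.
have short := @no_short_odd_cycle _ e e_sym e_irr S _ k hS _ nocyc.
have [|||c pr] := bipartite_of_no_C3_C5 e_sym e_irr hS.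
- by move: s_low k2; clear; lia.
- move=> s sS Us cs; apply: (short _ 1) => //; last by move: k2; clear; lia.
  by move: s_low k2; clear; lia.
- move=> s sS Us cs; apply: (short _ 2) => //.
  by move: s_low k2; clear; lia.
(* Bipartiteness halves the bound on adjacent pairs in [S], which improves the lower bound on its
   size. *)
have s_big : 8 * #|T| + 32 <= 9 * #|S|.
  apply: (dense_bip_card_lower k2 kn dense opt).
  rewrite (adj_pairs_bip e_sym pr).
  have := leq_adj_pairs e (S :&: [set x | c x]) (S :\: [set x | c x]).
  have := (nat_AGM2 #|S :&: [set x | c x]| #|S :\: [set x | c x]|).1.
  by rewrite cardsID -mulnn; clear; lia.
apply: (@core_structure _ _ e_sym e_irr k r S c) => //.
by move: le; rewrite leq_divRL // mulnC.
Qed.
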